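(* Let $n>1$ be an integer. There exist injective non-stable morphisms of vector bundles on $\mathbb{P}_2$ (injective as morphisms of sheaves) $$\phi:\mathcal{O}\otimes\mathbb{C}^{2n-1}\longrightarrow Q\otimes\mathbb{C}^{2n+1}$$ such that $\mathrm{coker}(\phi)$ is torsion free and simple.
   Context: $\mathbb{P}_2=\mathbb{P}(V)$ is the projective plane over $\mathbb{C}$ (lines in $V$, $\dim V=3$) and $Q=V\otimes\mathcal{O}/\mathcal{O}(-1)$ is the canonical rank 2 quotient bundle, so $\mathrm{Hom}(\mathcal{O},Q)=V$. A morphism $\phi:\mathcal{O}\otimes\mathbb{C}^m\to Q\otimes\mathbb{C}^k$ is regarded as a linear map $V^*\otimes\mathbb{C}^m\to\mathbb{C}^k$; it is stable if for all subspaces $M'\subset\mathbb{C}^m$, $N'\subset\mathbb{C}^k$ with $M'\ne\{0\}$, $N'\ne\mathbb{C}^k$ and $\phi(V^*\otimes M')\subset N'$, one has $\frac{\dim N'}{\dim M'}>\frac km$. A sheaf is simple if its only endomorphisms are the homotheties. *)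

(* Defs.v *)
From HB Require Import structures.
From mathcomp Require Import all_boot all_order all_algebra.
From mathcomp Require Import boolp classical_sets functions reals complex.
From mathcomp Require Import topology_structure.
From mathcomp Require Import mpoly.

Set Implicit Arguments.
Unset Strict Implicit.
Unset Printing Implicit Defensive.

Import GRing.Theory.

Local Open Scope classical_set_scope.
Local Open Scope ring_scope.

(* V = K^3; elements of V are row vectors, elements of V^* column vectors. *)
Definition P2 (K : closedFieldType) : Type :=
  {L : {vspace 'rV[K]_3} | \dim L == 1%N}.

HB.instance Definition _ (K : closedFieldType) := Choice.on (P2 K).

Definition line (K : closedFieldType) (x : P2 K) : {vspace 'rV[K]_3} := val x.

Definition peval (K : closedFieldType) (p : {mpoly K[3]}) (v : 'rV[K]_3) : K :=
  p.@[fun i => v ord0 i].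

Definition homogeneous (K : closedFieldType) (p : {mpoly K[3]}) : Prop :=
  exists d : nat, p \is d.-homog.

Definition zero_locus (K : closedFieldType) (S : set {mpoly K[3]}) :
    set (P2 K) :=
  [set x | forall p v, S p -> v \in line x -> peval p v = 0].

Definition zariski_open (K : closedFieldType) (U : set (P2 K)) : Prop :=
  exists S : set {mpoly K[3]}, (forall p, S p -> homogeneous p) /\
    U = ~` zero_locus S.

Section Zariski.
Context (K : closedFieldType).

Lemma line_gen (x : P2 K) :
  exists2 v : 'rV[K]_3, v != 0 & line x = <[v]>%VS.
Proof.
have /eqP dx : \dim (line x) == 1%N by rewrite /line (valP x).
exists (vpick (line x)); first by rewrite vpick0 -dimv_eq0 dx.
apply/eqP; rewrite eq_sym eqEdim -memvE memv_pick /= dx dim_vline.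
by rewrite vpick0 -dimv_eq0 dx.
Qed.

Lemma pevalZ d (p : {mpoly K[3]}) (a : K) v :
  p \is d.-homog -> peval p (a *: v) = a ^+ d * peval p v.
Proof.
move=> /dhomogP hp; rewrite /peval !mevalE mulr_sumr.
apply: eq_big_seq => m /hp <-; rewrite mulrCA; congr (_ * _).
transitivity (\prod_i (a ^+ m i * v ord0 i ^+ m i)).
  by apply: eq_bigr => i _; rewrite mxE exprMn.
by rewrite big_split /= prodrXr mdegE.
Qed.

Lemma pevalM (p q : {mpoly K[3]}) v : peval (p * q) v = peval p v * peval q v.
Proof. exact: rmorphM. Qed.

Lemma pevalB (p q : {mpoly K[3]}) v : peval (p - q) v = peval p v - peval q v.
Proof. exact: rmorphB. Qed.

Lemma zariski_openT : zariski_open [set: P2 K].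
Proof.
exists [set 1]; split=> [p ->|]; first by exists 0%N; rewrite dhomog1.
rewrite predeqE => x; split=> // _ h.
have := h 1 0 erefl (mem0v _); rewrite /peval rmorph1 => /eqP.
by rewrite oner_eq0.
Qed.

Lemma zariski_openI (U W : set (P2 K)) :
  zariski_open U -> zariski_open W -> zariski_open (U `&` W).
Proof.
move=> [S [hS ->]] [T [hT ->]].
exists [set r | exists p q, [/\ S p, T q & r = p * q]]; split.
  move=> _ [p [q [/hS[d hd] /hT[e he] ->]]].
  by exists (d + e)%N; apply: dhomogM.
rewrite -setCU; congr (~` _); rewrite predeqE => x; split.
  move=> [] h r v [p [q [Sp Tq ->]]] vx; rewrite pevalM.
    by rewrite (h p) // mul0r.
  by rewrite (h q) // mulr0.
move=> h; have [w w0 lx] := line_gen x.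
have wx : w \in line x by rewrite lx memv_line.
have [hSw|/existsNP[p /not_implyP[Sp pw]]] :=
  pselect (forall p, S p -> peval p w = 0).
  left=> p v Sp; rewrite lx => /vlineP[a ->].
  by have [d hd] := hS _ Sp; rewrite (pevalZ _ _ hd) hSw // mulr0.
right=> q v Tq; rewrite lx => /vlineP[a ->].
have [d hd] := hT _ Tq; rewrite (pevalZ _ _ hd).
have := h (p * q) w _ wx; rewrite pevalM => /(_ _)/eqP.
rewrite mulf_eq0 => /(_ _)/orP[|/eqP|/eqP->]; [|by []|by rewrite mulr0].
by exists p, q.
Qed.

Lemma zariski_open_bigU (I : Type) (f : I -> set (P2 K)) :
  (forall i, zariski_open (f i)) -> zariski_open (\bigcup_i f i).
Proof.
move=> /choice[S hS]; exists (\bigcup_i S i); split.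
  by move=> p [i _]; have [h _] := hS i; apply: h.
rewrite -[LHS]setCK; congr (~` _); rewrite setC_bigcup predeqE => x; split.
  by move=> h p v [i _ Sp] vx; have := h i Logic.I; have [_ ->] := hS i;
     rewrite setCK => /(_ p v Sp vx).
by move=> h i _; have [_ ->] := hS i; rewrite setCK => p v Sp; apply: h; exists i.
Qed.

End Zariski.

HB.instance Definition _ (K : closedFieldType) :=
  isOpenTopological.Build (P2 K) (@zariski_openT K) (@zariski_openI K)
    (@zariski_open_bigU K).

Record opens (K : closedFieldType) : Type := Opens {
  pts :> set (P2 K);
  opens_open : open pts }.

Definition opensI (K : closedFieldType) (U W : opens K) : opens K :=
  Opens (openI (opens_open U) (opens_open W)).

Definition mkpt (X : Type) (U : set X) (x : X) (h : U x) : set_type U :=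
  exist _ x (mem_set h).

Definition incl (X : Type) (W U : set X) (h : W `<=` U) (y : set_type W) :
    set_type U :=
  mkpt (h _ (set_valP y)).

(* f is locally a quotient p / q of homogeneous polynomials of equal degree. *)
Definition regular (K : closedFieldType) (U : opens K)
    (f : set_type (pts U) -> K) : Prop :=
  forall x : set_type (pts U), exists W : opens K, pts W (val x) /\
    exists (d : nat) (p q : {mpoly K[3]}),
      [/\ p \is d.-homog, q \is d.-homog &
        forall (y : set_type (pts U)) (v : 'rV[K]_3),
          pts W (val y) -> v \in line (val y) -> v != 0 ->
          peval q v != 0 /\ f y = peval p v / peval q v].

Definition regular_pred (K : closedFieldType) (U : opens K) :
    {pred (set_type (pts U) -> K)} :=
  fun f => `[< regular f >].

Section Regular.
Context (K : closedFieldType) (U : opens K).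

Lemma regular_const (c : K) : regular (fun _ : set_type (pts U) => c).
Proof.
move=> x; exists U; split; first exact: set_valP.
exists 0%N, (c *: 1), 1; split; [exact/rpredZ/dhomog1|exact: dhomog1|].
move=> y v _ _ _; rewrite /peval rmorph1 oner_eq0; split=> //.
by rewrite mevalZ rmorph1 mulr1 divr1.
Qed.

Lemma regular_subring : subring_closed (@regular_pred K U).
Proof.
split; first exact/asboolP/regular_const.
- move=> f g /asboolP hf /asboolP hg; apply/asboolP => x.
  have [W [Wx [d [p [q [hp hq H]]]]]] := hf x.
  have [W' [Wx' [d' [p' [q' [hp' hq' H']]]]]] := hg x.
  exists (opensI W W'); split=> //.
  exists (d + d')%N, (p * q' - p' * q), (q * q'); split.
  + by apply: rpredB; [|rewrite addnC]; apply: dhomogM.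
  + exact: dhomogM.
  + move=> y v [Wy Wy'] vy v0.
    have [q0 fE] := H y v Wy vy v0; have [q0' gE] := H' y v Wy' vy v0.
    rewrite pevalB !pevalM mulf_neq0 //; split=> //.
    by rewrite -[LHS]/(f y - g y) fE gE -mulNr addf_div // mulNr.
- move=> f g /asboolP hf /asboolP hg; apply/asboolP => x.
  have [W [Wx [d [p [q [hp hq H]]]]]] := hf x.
  have [W' [Wx' [d' [p' [q' [hp' hq' H']]]]]] := hg x.
  exists (opensI W W'); split=> //.
  exists (d + d')%N, (p * p'), (q * q'); split; try exact: dhomogM.
  move=> y v [Wy Wy'] vy v0.
  have [q0 fE] := H y v Wy vy v0; have [q0' gE] := H' y v Wy' vy v0.
  rewrite !pevalM mulf_neq0 //; split=> //.
  by rewrite -[LHS]/(f y * g y) fE gE mulf_div.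
Qed.

End Regular.

(* The ring O(U); it is the zero ring when U is empty. *)
Record regfun (K : closedFieldType) (U : opens K) : Type := MkO {
  Ofun :> set_type (pts U) -> K;
  OP : Ofun \in @regular_pred K U }.

HB.instance Definition _ (K : closedFieldType) (U : opens K) :=
  [isSub for @Ofun K U].
HB.instance Definition _ (K : closedFieldType) (U : opens K) :=
  [Choice of regfun U by <:].
HB.instance Definition _ (K : closedFieldType) (U : opens K) :=
  GRing.SubChoice_isSubComPzRing.Build _ (@regular_pred K U) (regfun U)
    (@regular_subring K U).

Section Ores.
Context (K : closedFieldType).

Lemma regular_res (U W : opens K) (h : pts W `<=` pts U) (f : regfun U) :
  regular (Ofun f \o incl h).
Proof.
move=> x; have /asboolP/(_ (incl h x))[A [Ax [d [p [q [hp hq H]]]]]] := OP f.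
exists A; split=> //; exists d, p, q; split=> // y v Ay vy v0.
exact: (H (incl h y)).
Qed.

Definition Ores (U W : opens K) (h : pts W `<=` pts U) (f : regfun U) : regfun W :=
  MkO (introT (asboolP _) (regular_res h f)).

Definition Oconst (U : opens K) (c : K) : regfun U :=
  MkO (introT (asboolP _) (@regular_const K U c)).

End Ores.

(* Sheaves of O-modules on P2. *)
Record omod (K : closedFieldType) : Type := OMod {
  sec :> forall U : opens K, lmodType (regfun U);
  res : forall U W : opens K, pts W `<=` pts U -> sec U -> sec W;
  resD : forall U W (h : pts W `<=` pts U) (s t : sec U),
    res h (s + t) = res h s + res h t;
  resZ : forall U W (h : pts W `<=` pts U) (f : regfun U) (s : sec U),
    res h (f *: s) = Ores h f *: res h s;
  res_id : forall U (h : pts U `<=` pts U) (s : sec U), res h s = s;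
  res_comp : forall U W A (h : pts W `<=` pts U) (h' : pts A `<=` pts W)
      (h'' : pts A `<=` pts U) (s : sec U),
    res h' (res h s) = res h'' s;
  res_glue : forall (I : Type) (U : opens K) (W : I -> opens K)
      (h : forall i, pts (W i) `<=` pts U) (s : forall i, sec (W i)),
    pts U `<=` \bigcup_i pts (W i) ->
    (forall i j,
      res (W := opensI (W i) (W j)) (@subIsetl _ _ _) (s i) =
      res (W := opensI (W i) (W j)) (@subIsetr _ _ _) (s j)) ->
    exists! t : sec U, forall i, res (h i) t = s i }.

Record omor (K : closedFieldType) (F G : omod K) : Type := OMor {
  mor :> forall U : opens K, {linear F U -> G U};
  morN : forall U W (h : pts W `<=` pts U) (s : F U),
    mor W (res h s) = res h (mor U s) }.

Definition injective_omor (K : closedFieldType) (F G : omod K)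
    (a : omor F G) : Prop :=
  forall U : opens K, injective (a U).

(* F --a--> G --p--> H --> 0 is exact as a sequence of sheaves. *)
Record is_coker (K : closedFieldType) (F G H : omod K)
    (a : omor F G) (p : omor G H) : Prop := IsCoker {
  coker_surj : forall (U : opens K) (t : H U) (x : P2 K), pts U x ->
    exists (W : opens K) (h : pts W `<=` pts U) (s : G W),
      pts W x /\ p W s = res h t;
  coker_ker : forall (U : opens K) (s : G U),
    p U s = 0 <->
    forall x : P2 K, pts U x ->
      exists (W : opens K) (h : pts W `<=` pts U) (r : F W),
        pts W x /\ a W r = res h s }.

(* P2 being irreducible, O(U) is an integral domain for U nonempty. *)
Definition torsion_free (K : closedFieldType) (F : omod K) : Prop :=
  forall (U : opens K) (f : regfun U) (s : F U), f *: s = 0 -> f = 0 \/ s = 0.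

Definition simple (K : closedFieldType) (F : omod K) : Prop :=
  forall e : omor F F, exists c : K,
    forall (U : opens K) (s : F U), e U s = Oconst U c *: s.

Lemma glue_fun (X T I : Type) (U : set X) (W : I -> set X)
    (h : forall i, W i `<=` U) (s : forall i, set_type (W i) -> T) :
  U `<=` \bigcup_i W i ->
  (forall i j (y : set_type (W i)) (z : set_type (W j)),
    \val y = \val z :> X -> s i y = s j z) ->
  exists f : set_type U -> T, forall i y, f (incl (h i) y) = s i y.
Proof.
move=> cov agree.
have /choice[f fE] : forall x : set_type U,
    exists t : T, forall i (y : set_type (W i)), \val y = \val x :> X -> s i y = t.
  move=> x; have [i _ Wx] := cov _ (set_valP x).
  exists (s i (mkpt Wx)) => j y yx.
  exact: agree.
by exists f => i y; rewrite -(fE (incl (h i) y) i y).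
Qed.

Lemma set_type_eq (X : Type) (A : set X) (x y : set_type A) :
  \val x = \val y :> X -> x = y.
Proof. exact: val_inj. Qed.

Section StructureSheaf.
Context (K : closedFieldType).

Lemma O_eq (U : opens K) (f g : regfun U) : (forall y, Ofun f y = Ofun g y) -> f = g.
Proof. by move=> h; apply: val_inj; apply: funext. Qed.

Lemma O_glue (I : Type) (U : opens K) (W : I -> opens K)
    (h : forall i, pts (W i) `<=` pts U) (s : forall i, regfun (W i)) :
  pts U `<=` \bigcup_i pts (W i) ->
  (forall i j,
    Ores (W := opensI (W i) (W j)) (@subIsetl _ _ _) (s i) =
    Ores (W := opensI (W i) (W j)) (@subIsetr _ _ _) (s j)) ->
  exists! t : regfun U, forall i, Ores (h i) t = s i.
Proof.
move=> cov agree.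
have [i j y z yz|f fE] := @glue_fun _ _ _ _ _ h (fun i => Ofun (s i)) cov.
  have Wz : (pts (W i) `&` pts (W j)) (\val y).
    by split; [exact: set_valP | rewrite yz; exact: set_valP].
  set w : set_type (pts (opensI (W i) (W j))) := mkpt Wz.
  have -> : y = incl (@subIsetl _ _ _) w by exact: set_type_eq.
  have -> : z = incl (@subIsetr _ _ _) w by exact: set_type_eq.
  exact: (congr1 (fun g => Ofun g w) (agree i j)).
have fr : regular f.
  move=> x; have [i _ Wx] := cov _ (set_valP x).
  have /asboolP/(_ (mkpt Wx)) := OP (s i).
  move=> [A [Ax [d [p [q [hp hq H]]]]]].
  exists (opensI A (W i)); split=> //; exists d, p, q; split=> //.
  move=> y v [Ay Wy] vy v0.
  have -> : y = incl (h i) (mkpt Wy) by exact: set_type_eq.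
  by rewrite fE; apply: H.
exists (MkO (introT (asboolP _) fr)); split=> [i|t tE].
  by apply: O_eq => y; apply: fE.
apply: O_eq => x; have [i _ Wx] := cov _ (set_valP x).
have -> : x = incl (h i) (mkpt Wx) by exact: set_type_eq.
by rewrite [LHS]fE -tE.
Qed.

Definition O_omod : omod K.
Proof.
refine (@OMod K (fun U => (regfun U)^o)
  (fun U W h (s : (regfun U)^o) => (Ores h s : (regfun W)^o)) _ _ _ _ O_glue).
- by move=> U W h s t; apply: O_eq.
- by move=> U W h f s; apply: O_eq.
- move=> U h s; apply: O_eq => y.
  by rewrite -[LHS]/(Ofun s (incl h y)); congr (Ofun s _); apply: set_type_eq.
- move=> U W A h h' h'' s; apply: O_eq => y.
  rewrite -[LHS]/(Ofun s (incl h (incl h' y))) -[RHS]/(Ofun s (incl h'' y)).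
  by congr (Ofun s _); apply: set_type_eq.
Defined.

End StructureSheaf.

(* V / L is modelled on the complement L^C of L: the class of v is the
   projection of v onto L^C along L. *)
Definition qclass (K : closedFieldType) (L : {vspace 'rV[K]_3})
    (v : 'rV[K]_3) : 'rV[K]_3 :=
  v - projv L v.

Lemma qclass_eq0 (K : closedFieldType) (L : {vspace 'rV[K]_3}) v :
  qclass L v = 0 <-> v \in L.
Proof.
rewrite /qclass; split=> [/eqP|vL]; last by rewrite projv_id ?subrr.
by rewrite subr_eq0 => /eqP->; apply: memv_proj.
Qed.

(* Sections of Q = V (x) O / O(-1): families s(y) in V / line y which locally
   lift to regular functions with values in V. *)
Definition qregular (K : closedFieldType) (U : opens K)
    (s : set_type (pts U) -> 'rV[K]_3) : Prop :=
  forall x : set_type (pts U),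
    exists (W : opens K) (h : pts W `<=` pts U) (g : 'I_3 -> regfun W),
      pts W (val x) /\
      forall y : set_type (pts W),
        s (incl h y) = qclass (line (val y)) (\row_i g i y).

Definition qregular_pred (K : closedFieldType) (U : opens K) :
    {pred (set_type (pts U) -> 'rV[K]_3)} :=
  fun s => `[< qregular s >].

Section QRegular.
Context (K : closedFieldType).

Lemma qclassB (L : {vspace 'rV[K]_3}) u v :
  qclass L (u - v) = qclass L u - qclass L v.
Proof. by rewrite /qclass linearB /= !opprD !opprK addrACA. Qed.

Lemma qclassZ (L : {vspace 'rV[K]_3}) c v :
  qclass L (c *: v) = c *: qclass L v.
Proof. by rewrite /qclass linearZ scalerBr. Qed.

Lemma qregular_const (U : opens K) (v : 'rV[K]_3) :
  qregular (fun y : set_type (pts U) => qclass (line (val y)) v).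
Proof.
move=> x; exists U, (@subset_refl _ _), (fun i => Oconst U (v ord0 i)).
split=> [|y]; first exact: set_valP.
by congr (qclass _ _); apply/rowP => i; rewrite mxE.
Qed.

Lemma qregular_res (U W : opens K) (h : pts W `<=` pts U)
    (s : set_type (pts U) -> 'rV[K]_3) : qregular s -> qregular (s \o incl h).
Proof.
move=> hs x; have [A [hA [g [Ax gE]]]] := hs (incl h x).
exists (opensI A W), (@subIsetr _ _ _).
exists (fun i => Ores (W := opensI A W) (@subIsetl _ _ _) (g i)).
split=> [|y]; first by split=> //; apply: set_valP.
rewrite -(gE (incl (@subIsetl _ _ _) y)) /=.
by congr (s _); apply: set_type_eq.
Qed.

Lemma qregularB (U : opens K) (s t : set_type (pts U) -> 'rV[K]_3) :
  qregular s -> qregular t -> qregular (s - t).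
Proof.
move=> hs ht x.
have [A [hA [f [Ax fE]]]] := hs x; have [B [hB [g [Bx gE]]]] := ht x.
have hAB : pts (opensI A B) `<=` pts U by move=> z [/hA].
exists (opensI A B), hAB, (fun i =>
  Ores (W := opensI A B) (@subIsetl _ _ _) (f i) -
  Ores (W := opensI A B) (@subIsetr _ _ _) (g i)).
split=> // y; rewrite -[LHS]/(s (incl hAB y) - t (incl hAB y)).
have -> : s (incl hAB y) = s (incl hA (incl (@subIsetl _ _ _) y)).
  by congr (s _); apply: set_type_eq.
have -> : t (incl hAB y) = t (incl hB (incl (@subIsetr _ _ _) y)).
  by congr (t _); apply: set_type_eq.
rewrite fE gE -qclassB; congr (qclass _ _).
by apply/rowP => i; rewrite !mxE.
Qed.

Lemma qregularZ (U : opens K) (f : regfun U) (s : set_type (pts U) -> 'rV[K]_3) :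
  qregular s -> qregular (fun y => Ofun f y *: s y).
Proof.
move=> hs x; have [A [hA [g [Ax gE]]]] := hs x.
exists A, hA, (fun i => Ores hA f * g i); split=> // y.
rewrite gE -qclassZ; congr (qclass _ _).
by apply/rowP => i; rewrite !mxE.
Qed.

Lemma qregular_zmod (U : opens K) : zmod_closed (@qregular_pred K U).
Proof.
split; last first.
  by move=> s t /asboolP hs /asboolP ht; apply/asboolP/qregularB.
apply/asboolP; have := @qregular_const U 0.
by congr qregular; apply: funext => y; rewrite /qclass linear0 subrr.
Qed.

End QRegular.

Record qsec (K : closedFieldType) (U : opens K) : Type := MkQ {
  Qfun :> set_type (pts U) -> 'rV[K]_3;
  QP : Qfun \in @qregular_pred K U }.

HB.instance Definition _ (K : closedFieldType) (U : opens K) :=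
  [isSub for @Qfun K U].
HB.instance Definition _ (K : closedFieldType) (U : opens K) :=
  [Choice of qsec U by <:].
HB.instance Definition _ (K : closedFieldType) (U : opens K) :=
  GRing.SubChoice_isSubZmodule.Build _ (@qregular_pred K U) (qsec U)
    (@qregular_zmod K U).

Section QSheaf.
Context (K : closedFieldType).

Lemma Q_eq (U : opens K) (s t : qsec U) : (forall y, Qfun s y = Qfun t y) -> s = t.
Proof. by move=> h; apply: val_inj; apply: funext. Qed.

Lemma QfunP (U : opens K) (s : qsec U) : qregular (Qfun s).
Proof. exact/asboolP/QP. Qed.

Definition Qscale (U : opens K) (f : regfun U) (s : qsec U) : qsec U :=
  MkQ (introT (asboolP _) (qregularZ f (QfunP s))).

Fact QscaleA U (f g : regfun U) s : Qscale f (Qscale g s) = Qscale (f * g) s.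
Proof. by apply: Q_eq => y; apply: scalerA. Qed.
Fact Qscale1 U : left_id 1 (@Qscale U).
Proof. by move=> s; apply: Q_eq => y; apply: scale1r. Qed.
Fact QscaleDr U : right_distributive (@Qscale U) +%R.
Proof. by move=> f s t; apply: Q_eq => y; apply: scalerDr. Qed.
Fact QscaleDl U (s : qsec U) : {morph (@Qscale U)^~ s : f g / f + g}.
Proof. by move=> f g; apply: Q_eq => y; apply: scalerDl. Qed.

HB.instance Definition _ (U : opens K) :=
  GRing.Zmodule_isLmodule.Build (regfun U) (qsec U)
    (@QscaleA U) (@Qscale1 U) (@QscaleDr U) (@QscaleDl U).

Definition Qres (U W : opens K) (h : pts W `<=` pts U) (s : qsec U) : qsec W :=
  MkQ (introT (asboolP _) (qregular_res h (QfunP s))).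

(* The element of H^0(Q) = V defined by v. *)
Definition Qconst (U : opens K) (v : 'rV[K]_3) : qsec U :=
  MkQ (introT (asboolP _) (@qregular_const K U v)).

Lemma Q_glue (I : Type) (U : opens K) (W : I -> opens K)
    (h : forall i, pts (W i) `<=` pts U) (s : forall i, qsec (W i)) :
  pts U `<=` \bigcup_i pts (W i) ->
  (forall i j,
    Qres (W := opensI (W i) (W j)) (@subIsetl _ _ _) (s i) =
    Qres (W := opensI (W i) (W j)) (@subIsetr _ _ _) (s j)) ->
  exists! t : qsec U, forall i, Qres (h i) t = s i.
Proof.
move=> cov agree.
have [i j y z yz|f fE] := @glue_fun _ _ _ _ _ h (fun i => Qfun (s i)) cov.
  have Wz : (pts (W i) `&` pts (W j)) (\val y).
    by split; [exact: set_valP | rewrite yz; exact: set_valP].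
  set w : set_type (pts (opensI (W i) (W j))) := mkpt Wz.
  have -> : y = incl (@subIsetl _ _ _) w by exact: set_type_eq.
  have -> : z = incl (@subIsetr _ _ _) w by exact: set_type_eq.
  exact: (congr1 (fun g => Qfun g w) (agree i j)).
have fr : qregular f.
  move=> x; have [i _ Wx] := cov _ (set_valP x).
  have [A [hA [g [Ax gE]]]] := QfunP (s i) (mkpt Wx).
  have hAU : pts A `<=` pts U by move=> z /hA/h.
  exists A, hAU, g; split=> // y; rewrite -gE -fE.
  by congr (f _); apply: set_type_eq.
exists (MkQ (introT (asboolP _) fr)); split=> [i|t tE].
  by apply: Q_eq => y; apply: fE.
apply: Q_eq => x; have [i _ Wx] := cov _ (set_valP x).
have -> : x = incl (h i) (mkpt Wx) by exact: set_type_eq.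
by rewrite [LHS]fE -tE.
Qed.

Definition Q_omod : omod K.
Proof.
refine (@OMod K (@qsec K : forall U, lmodType (regfun U)) Qres _ _ _ _ Q_glue).
- by move=> U W h s t; apply: Q_eq.
- by move=> U W h f s; apply: Q_eq.
- move=> U h s; apply: Q_eq => y.
  by rewrite -[LHS]/(Qfun s (incl h y)); congr (Qfun s _); apply: set_type_eq.
- move=> U W A h h' h'' s; apply: Q_eq => y.
  rewrite -[LHS]/(Qfun s (incl h (incl h' y))) -[RHS]/(Qfun s (incl h'' y)).
  by congr (Qfun s _); apply: set_type_eq.
Defined.

End QSheaf.

(* F (x) K^k, the direct sum of k copies of F. *)
Section Power.
Context (K : closedFieldType) (F : omod K) (k : nat).

Definition power_res (U W : opens K) (h : pts W `<=` pts U)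
    (s : {ffun 'I_k -> F U}) : {ffun 'I_k -> F W} :=
  [ffun l => res h (s l)].

Lemma power_glue (I : Type) (U : opens K) (W : I -> opens K)
    (h : forall i, pts (W i) `<=` pts U) (s : forall i, {ffun 'I_k -> F (W i)}) :
  pts U `<=` \bigcup_i pts (W i) ->
  (forall i j,
    power_res (W := opensI (W i) (W j)) (@subIsetl _ _ _) (s i) =
    power_res (W := opensI (W i) (W j)) (@subIsetr _ _ _) (s j)) ->
  exists! t : {ffun 'I_k -> F U}, forall i, power_res (h i) t = s i.
Proof.
move=> cov agree.
have /choice[t tP] : forall l, exists t : F U,
    unique (fun t => forall i, res (h i) t = s i l) t.
  move=> l; apply: (res_glue h cov) => i j.
  by have /ffunP/(_ l) := agree i j; rewrite !ffunE.
exists [ffun l => t l]; split=> [i|t' t'E].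
  by apply/ffunP => l; rewrite !ffunE; have [-> //] := tP l.
apply/ffunP => l; rewrite ffunE; have [_] := tP l; apply => i.
by rewrite -t'E ffunE.
Qed.

Definition power : omod K.
Proof.
refine (@OMod K (fun U => {ffun 'I_k -> F U} : lmodType (regfun U)) power_res
  _ _ _ _ power_glue).
- by move=> U W h s t; apply/ffunP => l; rewrite !ffunE resD.
- by move=> U W h f s; apply/ffunP => l; rewrite !ffunE resZ.
- by move=> U h s; apply/ffunP => l; rewrite !ffunE res_id.
- by move=> U W A h h' h'' s; apply/ffunP => l; rewrite !ffunE (res_comp _ _ h'').
Defined.

End Power.

(* V^* (x) K^m is the space of 3 x m matrices, with xi (x) mu = xi *m mu.
   A linear map phi : V^* (x) K^m -> K^k corresponds to the tensor
   \sum_i e_i (x) phi(e_i^* (x) -) in V (x) Hom(K^m, K^k), hence to a morphism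
   O (x) K^m -> Q (x) K^k because V = Hom(O, Q). *)
Section BundleMap.
Context (K : closedFieldType) (m k : nat).
Implicit Type phi : 'Hom('M[K]_(3, m), 'rV[K]_k).

(* The coefficient of phi in V from the j-th copy of O to the l-th copy of Q. *)
Definition phi_coef phi (j : 'I_m) (l : 'I_k) : 'rV[K]_3 :=
  \row_(i < 3) phi (delta_mx i j) ord0 l.

Definition bundle_fun phi (U : opens K)
    (f : power (O_omod K) m U) : power (Q_omod K) k U :=
  [ffun l : 'I_k => \sum_(j < m) (f j : regfun U) *: Qconst U (phi_coef phi j l)].

Fact bundle_fun_linear phi U : linear (bundle_fun phi (U := U)).
Proof.
move=> a f g; apply/ffunP => l; rewrite !ffunE scaler_sumr -big_split /=.
by apply: eq_bigr => j _; rewrite !ffunE scalerDl scalerA.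
Qed.

HB.instance Definition _ phi U :=
  GRing.isLinear.Build (regfun U) (power (O_omod K) m U) (power (Q_omod K) k U) _
    (bundle_fun phi (U := U)) (bundle_fun_linear phi (U := U)).

Definition bundle_map phi : omor (power (O_omod K) m) (power (Q_omod K) k).
Proof.
refine (@OMor K _ _ (fun U => bundle_fun phi (U := U)) _).
move=> U W h f; apply/ffunP => l; rewrite !ffunE.
have resS : {morph @Qres K U W h : s t / s + t} by move=> s t; apply: Q_eq.
rewrite -[RHS]/(Qres h _) (big_morph _ resS (_ : _ = 0)); last exact: Q_eq.
apply: eq_bigr => j _; rewrite ffunE; exact: Q_eq.
Defined.

Definition stable phi : Prop :=
  forall (M' : {vspace 'rV[K]_m}) (N' : {vspace 'rV[K]_k}),
    M' != 0%VS -> N' != fullv ->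
    (forall (xi : 'cV[K]_3) (mu : 'rV[K]_m), mu \in M' -> phi (xi *m mu) \in N') ->
    (k%:R / m%:R < (\dim N')%:R / (\dim M')%:R :> rat).

End BundleMap.

(* Main.v *)
(* Proof idea. Put q = n - 1 and regard C^(2n-1) and C^(2n+1) as spaces of pairs
   of polynomials, of degrees at most (q, q - 1) and (q + 1, q). The morphism phi
   has components A_0 = 1, A_1 = multiplication by X and
   A_2 (p, r) = (p + X^2 r, 0). It is injective on every fibre of the bundles, so
   its cokernel F is a vector bundle, whose fibre at the line of v is the quotient
   of V (x) N, N = C^(2n+1), by H_v = v (x) N + phi(M), M = C^(2n-1). The pairs
   (p, 0) form a destabilizing submodule.

   With g = (g_0, g_1, g_2) in V (x) N and h_ij = v_i g_j - v_j g_i, the linear map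
   g |-> X h_02 - h_12 - A_2 h_01 vanishes on H_v and has kernel H_v for general v.
   It embeds the torsion free sheaf F in a sum of copies of O(1), and global
   sections of O(1) are linear forms (as one sees by restricting to lines). Solving
   the resulting equations between polynomials gives H^0(F) = V (x) N / phi(M). So
   an endomorphism of F comes from an endomorphism E of V (x) N preserving every
   H_v; polarizing in v shows that E = 1 (x) beta modulo phi(M), and beta has to be
   an endomorphism of the Kronecker module phi, hence a scalar. *)

From HB Require Import structures.
From mathcomp Require Import all_boot all_order all_algebra.
From mathcomp Require Import boolp classical_sets functions filter.
From mathcomp Require Import topology_structure reals complex.
From mathcomp Require Import mpoly ring zify.
Require Import Defs.

Set Implicit Arguments.
Unset Strict Implicit.
Unset Printing Implicit Defensive.

Import GRing.Theory Num.Theory.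

Local Open Scope classical_set_scope.
Local Open Scope ring_scope.

(** * Points of P2 and irreducibility *)

(** Over K[X], A_2 is the matrix with rows (1, X^2) and (0, 0); being K[X]-linear it commutes with
    multiplication by X, and the linear map of the overview is built on this. On the chart v = (1,
    c, z) the relation h_12 = c h_02 - z h_01 turns that map into (X - c) h_02 + (z - A_2) h_01. The
    matrix z - A_2 is invertible unless z is 0 or 1, the eigenvalues of A_2. So H_v is identified
    with the kernel only away from these values, and conclusions are carried to the remaining points
    by irreducibility of the plane and regularity of coordinates on H_v. The shape of A_2 serves
    simplicity. Compatibility with A_0 and A_1 leaves the maps (p, r) |-> (c p + s r, d r) with c, d
    constant and deg s <= 1; compatibility with A_2 at (0, 1) reads c X^2 = s + d X^2. The summand p
    of A_2 makes s appear in this equation, and 2 is the least exponent beyond the degree of s, so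
    that c = d and s = 0. The equation requires (0, 1) in M, that is q > 0, or n > 1. *)

Section Lines.
Context (K : closedFieldType).
Implicit Types (P Q : {poly K}) (v w : 'rV[K]_3) (x y : P2 K).

(** A root of P + 1 would give 1 = 0, so over the closed field P + 1 is a constant, and its value at
    0 is 1. This avoids counting the elements of [K]. *)
Lemma poly_eq0_horner P : (forall t, P.[t] = 0) -> P = 0.
Proof.
move=> P0; have [/eqP/size_poly1P[c _ PE]|] := eqVneq (size (P + 1)) 1%N.
  have := P0 0; rewrite -[P](addrK 1) PE hornerD hornerN !hornerC => /eqP.
  by rewrite subr_eq0 => /eqP ->; rewrite polyC1 subrr.
move=> /closed_rootP[t]; rewrite /root hornerD hornerC P0 add0r.
by rewrite oner_eq0.
Qed.

Lemma poly_neq0_horner P : P != 0 -> exists t, P.[t] != 0.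
Proof.
move=> P0; apply: contrapT => h; move/eqP: P0; apply.
by apply: poly_eq0_horner => t; apply: contrapT => /eqP Pt; apply: h; exists t.
Qed.

Definition line_poly (p : {mpoly K[3]}) v w : {poly K} :=
  \sum_(m <- msupp p) (p@_m)%:P *
    \prod_i ((v ord0 i)%:P + (w ord0 i)%:P * 'X) ^+ m i.

Lemma horner_line_poly p v w t :
  (line_poly p v w).[t] = peval p (v + t *: w).
Proof.
rewrite /peval mevalE horner_sum; apply: eq_bigr => m _.
rewrite hornerM hornerC horner_prod; congr (_ * _); apply: eq_bigr => i _.
by rewrite horner_exp !hornerE !mxE mulrC.
Qed.

Lemma exists_point : exists L : {vspace 'rV[K]_3}, \dim L == 1%N.
Proof.
exists <[const_mx 1 : 'rV[K]_3]>%VS; rewrite dim_vline.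
have [/matrixP/(_ ord0 ord0)|//] := eqVneq (const_mx 1 : 'rV[K]_3) 0.
by rewrite !mxE => /eqP; rewrite oner_eq0.
Qed.

(* A junk value when v = 0. *)
Definition point v : P2 K :=
  insubd (exist _ (xchoose exists_point) (xchooseP exists_point)
    : {L : {vspace 'rV[K]_3} | \dim L == 1%N}) <[v]>%VS.

Lemma line_point v : v != 0 -> line (point v) = <[v]>%VS.
Proof. by move=> v0; rewrite /line /point val_insubd dim_vline v0. Qed.

Lemma mem_point v : v != 0 -> v \in line (point v).
Proof. by move=> v0; rewrite line_point // memv_line. Qed.

Lemma line_mem x v : v != 0 -> v \in line x -> line x = <[v]>%VS.
Proof.
move=> v0; have [w w0 ->] := line_gen x => vw; apply/eqP.
by rewrite eq_sym eqEdim -memvE vw !dim_vline v0 w0.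
Qed.

Lemma point_mem x v : v != 0 -> v \in line x -> point v = x.
Proof. by move=> v0 vx; apply: val_inj;
  rewrite [LHS]line_point // -(line_mem v0 vx). Qed.

Lemma peval_homog_line d (p : {mpoly K[3]}) x v w : p \is d.-homog ->
  v \in line x -> w \in line x -> v != 0 -> peval p w != 0 -> peval p v != 0.
Proof.
move=> hp vx wx v0; rewrite (line_mem v0 vx) in wx; case/vlineP: wx => a ->.
by rewrite (pevalZ _ _ hp) mulf_eq0 => /norP[].
Qed.

Lemma open_basic (U : set (P2 K)) x : open U -> U x ->
  exists d (h : {mpoly K[3]}), [/\ h \is d.-homog,
    forall v, v \in line x -> v != 0 -> peval h v != 0 &
    forall y v, v \in line y -> peval h v != 0 -> U y].
Proof.
move=> [S [hS ->]] /existsNP[p /existsNP[v /not_implyP[Sp /not_implyP[vx /eqP pv]]]].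
have [d hd] := hS p Sp; exists d, p; split=> //.
  by move=> w wx w0; apply: (peval_homog_line hd wx vx).
by move=> y w wy /eqP pw h; apply: pw; apply: h.
Qed.

Lemma basic_open d (h : {mpoly K[3]}) : h \is d.-homog ->
  open [set y : P2 K | forall v, v \in line y -> v != 0 -> peval h v != 0].
Proof.
move=> hh; exists [set h]; split=> [_ ->|]; first by exists d.
rewrite predeqE => y; split=> [hy z|].
  have [v v0 ly] := line_gen y; have vy : v \in line y by rewrite ly memv_line.
  by have /eqP := hy v vy v0; apply; apply: z.
move=> /existsNP[p /existsNP[v /not_implyP[-> /not_implyP[vy /eqP hv]]]] w wy w0.
exact: peval_homog_line hh wy vy w0 hv.
Qed.

(** Irreducibility of the plane: on the line joining the two points, each basic open set is the
    complement of the zeros of a nonzero polynomial in one variable. *)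
Lemma open_meet (U W : set (P2 K)) x y : open U -> open W -> U x -> W y ->
  (U `&` W) !=set0.
Proof.
move=> oU oW Ux Wy.
have [d [g [hg gx gU]]] := open_basic oU Ux.
have [e [h [hh hy hW]]] := open_basic oW Wy.
have [v v0 lx] := line_gen x; have [w w0 ly] := line_gen y.
have vx : v \in line x by rewrite lx memv_line.
have wy : w \in line y by rewrite ly memv_line.
have [i vi] : exists i, v ord0 i != 0.
  by apply/existsP; apply: contraNT v0 => /existsPn h0; apply/eqP/rowP => i;
     rewrite mxE; apply/eqP/negPn/h0.
(* A coordinate that is nonzero at v: keeping it nonzero keeps v + t (w - v) nonzero, even when v
   and w are proportional. *)
pose c := (v ord0 i)%:P + ((w - v) ord0 i)%:P * 'X.
have cE t : c.[t] = (v + t *: (w - v)) ord0 i.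
  by rewrite !hornerE !mxE mulrC.
have /poly_neq0_horner[t] : line_poly g v (w - v) * line_poly h v (w - v) * c != 0.
  rewrite !mulf_neq0 //.
  - by apply: contraNneq (gx v vx v0) => E;
       rewrite -[v]addr0 -[X in _ + X](scale0r (w - v)) -horner_line_poly E horner0.
  - by apply: contraNneq (hy w wy w0) => E;
       rewrite -[w](subrKC v) -[X in _ + X](scale1r (w - v)) -horner_line_poly E
         horner0.
  - by apply: contraNneq vi => E;
       have := cE 0; rewrite E horner0 scale0r addr0 => <-.
rewrite !hornerM !mulf_eq0 !negb_or !horner_line_poly cE => /andP[/andP[gt ht] ct].
have u0 : v + t *: (w - v) != 0 by apply: contraNneq ct => ->; rewrite mxE.
exists (point (v + t *: (w - v))); split.
  exact: (gU _ _ (mem_point u0)).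
exact: (hW _ _ (mem_point u0)).
Qed.

End Lines.

(** * Germs of regular functions *)

Section RegularNear.
Context (K : closedFieldType).
Implicit Types (x y : P2 K) (f g : P2 K -> K) (U W : opens K).

(* Germs of regular functions are represented by total functions on P2, which
   avoids restriction maps. *)
Definition regular_near x f : Prop :=
  exists (d : nat) (p q : {mpoly K[3]}), [/\ p \is d.-homog, q \is d.-homog &
    \forall y \near x, forall v, v \in line y -> v != 0 ->
      peval q v != 0 /\ f y = peval p v / peval q v].

Lemma pevalD (p q : {mpoly K[3]}) v : peval (p + q) v = peval p v + peval q v.
Proof. exact: rmorphD. Qed.

Lemma near_opens x (P : P2 K -> Prop) :
  (\forall y \near x, P y) <-> exists W, pts W x /\ forall y, pts W y -> P y.
Proof.
rewrite /prop_near1 nbhsE; split=> [[A [oA Ax] AP]|[W [Wx WP]]].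
  by exists (Opens oA).
by exists (pts W) => //; split=> //; apply: opens_open.
Qed.

Lemma near_and x (P Q R : P2 K -> Prop) : (\forall y \near x, P y) ->
  (\forall y \near x, Q y) -> (forall y, P y -> Q y -> R y) ->
  \forall y \near x, R y.
Proof. by move=> Px Qx PQR; apply: (@filterS2 _ (nbhs x) _ P Q R). Qed.

Lemma near_conj x (P Q : P2 K -> Prop) : (\forall y \near x, P y) ->
  (\forall y \near x, Q y) -> \forall y \near x, P y /\ Q y.
Proof. by move=> Px Qx; apply: (near_and Px Qx). Qed.

Lemma regular_near_near x f : regular_near x f ->
  \forall y \near x, regular_near y f.
Proof.
move=> [d [p [q [hp hq /near_opens[W [Wx H]]]]]].
apply/near_opens; exists W; split=> // y Wy; exists d, p, q; split=> //.
by apply/near_opens; exists W.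
Qed.

Lemma regular_near_const x (c : K) : regular_near x (fun=> c).
Proof.
exists 0%N, (c *: 1), 1; split; [exact/rpredZ/dhomog1|exact: dhomog1|].
apply: (@filterE _ (nbhs x)) => y v _ _; rewrite /peval rmorph1 oner_eq0; split=> //.
by rewrite mevalZ rmorph1 mulr1 divr1.
Qed.

Lemma regular_nearD x f g : regular_near x f -> regular_near x g ->
  regular_near x (fun y => f y + g y).
Proof.
move=> [d [p [q [hp hq H]]]] [d' [p' [q' [hp' hq' H']]]].
exists (d + d')%N, (p * q' + p' * q), (q * q'); split.
- by apply: rpredD; [|rewrite addnC]; apply: dhomogM.
- exact: dhomogM.
apply: (near_and H H') => {H H'} y H H' v vy v0.
have [q0 ->] := H v vy v0; have [q0' ->] := H' v vy v0.
split; first by rewrite pevalM mulf_neq0.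
by rewrite pevalD !pevalM addf_div.
Qed.

Lemma regular_nearM x f g : regular_near x f -> regular_near x g ->
  regular_near x (fun y => f y * g y).
Proof.
move=> [d [p [q [hp hq H]]]] [d' [p' [q' [hp' hq' H']]]].
exists (d + d')%N, (p * p'), (q * q'); split; try exact: dhomogM.
apply: (near_and H H') => {H H'} y H H' v vy v0.
have [q0 ->] := H v vy v0; have [q0' ->] := H' v vy v0.
split; first by rewrite pevalM mulf_neq0.
by rewrite !pevalM mulf_div.
Qed.

Lemma regular_near_neq0 x f : f x != 0 -> regular_near x f ->
  \forall y \near x, f y != 0.
Proof.
move=> fx [d [p [q [hp _ H]]]].
have pv w : w \in line x -> w != 0 -> peval p w != 0.
  move=> wx w0; have [_ fE] := nbhs_singleton H w wx w0.
  by apply: contraNneq fx => pw; rewrite fE pw mul0r.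
have Hp : \forall y \near x, forall w, w \in line y -> w != 0 -> peval p w != 0.
  by apply: open_nbhs_nbhs; split; [exact: basic_open hp | exact: pv].
apply: (near_and H Hp) => {H Hp} y H Hp.
have [w w0 ly] := line_gen y; have wy : w \in line y by rewrite ly memv_line.
by have [q0 ->] := H w wy w0; rewrite mulf_neq0 ?invr_eq0 // Hp.
Qed.

Lemma regular_nearV x f : f x != 0 -> regular_near x f ->
  regular_near x (fun y => (f y)^-1).
Proof.
move=> fx rf; have f0 := regular_near_neq0 fx rf.
have [d [p [q [hp hq H]]]] := rf; exists d, q, p; split=> //.
apply: (near_and H f0) => {H f0} y H f0 w wy w0.
have [q0 fE] := H w wy w0; rewrite fE invf_div; split=> //.
by apply: contraNneq f0 => pw; rewrite fE pw mul0r.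
Qed.

Lemma regular_near_sum x (I : Type) (r : seq I) (P : pred I) (f : I -> P2 K -> K) :
  (forall i, P i -> regular_near x (f i)) ->
  regular_near x (fun y => \sum_(i <- r | P i) f i y).
Proof.
move=> h; elim: r => [|i r IH].
  by rewrite (_ : (fun _ => _) = fun=> 0) //;
     [apply: regular_near_const | apply/funext => y; rewrite big_nil].
have := IH; case Pi: (P i); last first.
  by congr regular_near; apply/funext => y; rewrite big_cons Pi.
move=> /(regular_nearD (h i Pi)).
by congr regular_near; apply/funext => y; rewrite big_cons Pi.
Qed.

Lemma regular_near_prod x (I : Type) (r : seq I) (P : pred I) (f : I -> P2 K -> K) :
  (forall i, P i -> regular_near x (f i)) ->
  regular_near x (fun y => \prod_(i <- r | P i) f i y).
Proof.
move=> h; elim: r => [|i r IH].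
  by rewrite (_ : (fun _ => _) = fun=> 1) //;
     [apply: regular_near_const | apply/funext => y; rewrite big_nil].
have := IH; case Pi: (P i); last first.
  by congr regular_near; apply/funext => y; rewrite big_cons Pi.
move=> /(regular_nearM (h i Pi)).
by congr regular_near; apply/funext => y; rewrite big_cons Pi.
Qed.

(** If f x were nonzero, the numerator of f would be nonzero on an open neighbourhood of x, and this
    neighbourhood would meet D by irreducibility. *)
Lemma regular_near_eq0 x f (D : set (P2 K)) : open D -> D !=set0 ->
  regular_near x f -> (\forall y \near x, D y -> f y = 0) -> f x = 0.
Proof.
move=> oD [z Dz] [d [p [q [hp hq H]]]] fD; apply: contrapT => /eqP fx.
have [v v0 lx] := line_gen x; have vx : v \in line x by rewrite lx memv_line.
have [q0 fE] := nbhs_singleton H v vx v0.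
have pv : peval p v != 0 by apply: contraNneq fx => pv; rewrite fE pv mul0r.
have /near_opens[W [Wx WH]] := near_conj H fD.
pose Z := [set y : P2 K | forall v, v \in line y -> v != 0 -> peval p v != 0].
have oZ : open (Z `&` pts W) by apply: openI (opens_open W); apply: basic_open hp.
have Zx : (Z `&` pts W) x.
  by split=> // w wx w0; apply: (peval_homog_line hp wx vx w0 pv).
have [y [[Zy Wy] Dy]] := open_meet oZ oD Zx Dz.
have [Hy fy0] := WH y Wy.
have [w w0 ly] := line_gen y; have wy : w \in line y by rewrite ly memv_line.
have [qw /esym] := Hy w wy w0; rewrite (fy0 Dy) => /eqP.
by rewrite mulf_eq0 invr_eq0 (negPf qw) orbF; apply/negP/Zy.
Qed.

Definition extend0 U (f : set_type (pts U) -> K) x : K :=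
  if pselect (pts U x) is left h then f (mkpt h) else 0.

Lemma extend0E U (f : set_type (pts U) -> K) (y : set_type (pts U)) :
  extend0 f (val y) = f y.
Proof.
rewrite /extend0; case: pselect => [h|]; first by congr f; apply: set_type_eq.
by case; apply: set_valP.
Qed.

Lemma regular_near_extend0 U (f : regfun U) x : pts U x ->
  regular_near x (extend0 (Ofun f)).
Proof.
move=> Ux; have /asboolP/(_ (mkpt Ux))[W [Wx [d [p [q [hp hq H]]]]]] := OP f.
exists d, p, q; split=> //; apply/near_opens; exists (opensI W U); split=> //.
move=> y [Wy Uy] v vy v0; rewrite -[y]/(val (mkpt Uy)) extend0E.
exact: H.
Qed.

(** The way back from germs to sections: a single [W] serves the whole finite family together with
    one further local property. *)
Lemma regular_near_regfun (I : finType) x (f : I -> P2 K -> K) (P : P2 K -> Prop) :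
  (forall i, regular_near x (f i)) -> (\forall y \near x, P y) ->
  exists W (g : I -> regfun W), [/\ pts W x, forall y, pts W y -> P y &
    forall i (y : set_type (pts W)), g i y = f i (val y)].
Proof.
move=> fx Px.
have : \forall y \near x, (forall i, regular_near y (f i)) /\ P y.
  apply: (@filterI _ (nbhs x)) => //.
  by apply: (@filter_forall _ I _ (nbhs x)) => i; apply: regular_near_near.
move=> /near_opens[W [Wx WH]].
have reg i : regular (fun y : set_type (pts W) => f i (val y)).
  move=> y; have [/(_ i)[d [p [q [hp hq /near_opens[A [Ay H]]]]]] _] :=
    WH _ (set_valP y).
  by exists A; split=> //; exists d, p, q; split=> // z v Az vz v0; apply: H.
exists W, (fun i => MkO (introT (asboolP _) (reg i))); split=> // y Wy.
by have [] := WH y Wy.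
Qed.

(** An arbitrary choice, which does not vary regularly with x; only ratios of its coordinates are
    regular, where the denominator is nonzero. *)
Definition gen x : 'rV[K]_3 := vpick (line x).

Lemma gen_neq0 x : gen x != 0.
Proof. by rewrite vpick0 -dimv_eq0 /line (eqP (valP x)). Qed.

Lemma gen_mem x : gen x \in line x.
Proof. exact: memv_pick. Qed.

Lemma line_genE x : line x = <[gen x]>%VS.
Proof. exact: line_mem (gen_neq0 x) (gen_mem x). Qed.

Lemma regular_near_ratio x i j : gen x ord0 i != 0 ->
  regular_near x (fun y => gen y ord0 j / gen y ord0 i).
Proof.
have hX l : ('X_l : {mpoly K[3]}) \is 1.-homog.
  by rewrite dhomogX; apply/eqP/mdeg1.
move=> xi; exists 1%N, 'X_j, 'X_i; split; [exact: hX|exact: hX|].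
have pX k v : peval 'X_k v = v ord0 k by rewrite /peval mevalXU.
have : \forall y \near x, forall w, w \in line y -> w != 0 -> peval 'X_i w != 0.
  apply: open_nbhs_nbhs; split; first exact: basic_open (hX i).
  move=> w wx w0; apply: (peval_homog_line (hX i) wx (gen_mem x) w0).
  by rewrite pX.
apply: filterS => y H v vy v0; split; first exact: H.
rewrite !pX; have := H v vy v0; rewrite pX.
move: (vy); rewrite line_genE => /vlineP[a ->]; rewrite !mxE mulf_eq0.
by case/norP=> a0 g0; rewrite -mulf_div divff // mul1r.
Qed.

Lemma gen_coord_neq0 x : exists i, gen x ord0 i != 0.
Proof.
apply/existsP; apply: contraNT (gen_neq0 x) => /existsPn h0.
by apply/eqP/rowP => i; rewrite mxE; apply/eqP/negPn/h0.
Qed.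

End RegularNear.

(** * Matrices of germs of regular functions *)

Section MatrixNear.
Context (K : closedFieldType).
Implicit Types (x y : P2 K).

Definition mx_near x a b (A : P2 K -> 'M[K]_(a, b)) : Prop :=
  forall i j, regular_near x (fun y => A y i j).

Lemma mx_near_const x a b (A : 'M[K]_(a, b)) : mx_near x (fun=> A).
Proof. by move=> i j; apply: regular_near_const. Qed.

Lemma mx_nearM x a b c (A : P2 K -> 'M[K]_(a, b)) (B : P2 K -> 'M[K]_(b, c)) :
  mx_near x A -> mx_near x B -> mx_near x (fun y => A y *m B y).
Proof.
move=> hA hB i j; under eq_fun => y do rewrite mxE.
by apply: regular_near_sum => l _; apply: regular_nearM.
Qed.

Lemma mx_near_det x a (A : P2 K -> 'M[K]_a) :
  mx_near x A -> regular_near x (fun y => \det (A y)).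
Proof.
move=> hA; rewrite /determinant; apply: regular_near_sum => s _.
apply: regular_nearM; first exact: regular_near_const.
by apply: regular_near_prod.
Qed.

Lemma mx_near_adj x a (A : P2 K -> 'M[K]_a) :
  mx_near x A -> mx_near x (fun y => \adj (A y)).
Proof.
move=> hA i j; under eq_fun => y do rewrite mxE.
apply: regular_nearM; first exact: regular_near_const.
apply: mx_near_det => i' j'; under eq_fun => y do rewrite !mxE.
exact: hA.
Qed.

(** If B is a right inverse of the single matrix [G x], then [G y *m B] stays invertible for y near
    x, and the adjugate formula shows that its inverse has regular entries. *)
Lemma mx_near_left_inverse x a b (G : P2 K -> 'M[K]_(a, b)) :
  mx_near x G -> row_free (G x) ->
  exists2 P : P2 K -> 'M[K]_(b, a), mx_near x P &
    \forall y \near x, G y *m P y = 1%:M.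
Proof.
move=> hG /row_freeP[B GB]; pose D y := G y *m B.
have hD : mx_near x D by apply: mx_nearM hG _; apply: mx_near_const.
have dx : \det (D x) != 0 by rewrite /D GB det1 oner_eq0.
have hd := mx_near_det hD.
exists (fun y => B *m ((\det (D y))^-1 *: \adj (D y))).
  apply: mx_nearM; first exact: mx_near_const.
  move=> i j; under eq_fun => y do rewrite mxE.
  apply: regular_nearM; first exact: regular_nearV dx hd.
  exact: mx_near_adj.
move: (regular_near_neq0 dx hd); apply: filterS => y dy.
by rewrite mulmxA -/(D y) -scalemxAr mul_mx_adj scale_scalar_mx mulVf.
Qed.

End MatrixNear.

(** * The fibres of the cokernel *)

Section Tensor.
Context (K : closedFieldType) (m k : nat).
Variable phi : 'Hom('M[K]_(3, m), 'rV[K]_k).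
Implicit Types (x y : P2 K) (u : 'rV[K]_m) (w : 'rV[K]_k) (v : 'rV[K]_3)
  (g : 'M[K]_(k, 3)).

(* V (x) K^k is the space of k x 3 matrices, the l-th row being the component in
   the l-th copy of V; so w (x) v is w^T *m v. *)
Definition tensor u : 'M[K]_(k, 3) :=
  \matrix_(l, i) \sum_j u ord0 j * phi_coef phi j l ord0 i.

Fact tensor_linear : linear tensor.
Proof.
move=> a u u'; apply/matrixP => l i; rewrite !mxE mulr_sumr -big_split /=.
by apply: eq_bigr => j _; rewrite !mxE mulrDl mulrA.
Qed.

HB.instance Definition _ :=
  GRing.isLinear.Build K 'rV[K]_m 'M[K]_(k, 3) _ tensor tensor_linear.

Lemma row_tensor u l : row l (tensor u) = \sum_j u ord0 j *: phi_coef phi j l.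
Proof.
apply/rowP => i; rewrite !mxE summxE; apply: eq_bigr => j _.
by rewrite [RHS]mxE.
Qed.

(** H_v of the overview, for v = [gen x]; [fiber_subP] shows that any other nonzero vector of the
    line gives the same subspace. *)
Definition fiber_sub x : {vspace 'M[K]_(k, 3)} :=
  (limg (linfun tensor) + limg (linfun (mulmxr (gen x) \o @trmx K 1 k)))%VS.

Lemma fiber_subP x g v : v \in line x -> v != 0 ->
  reflect (exists u w, g = tensor u + w^T *m v) (g \in fiber_sub x).
Proof.
move=> vx v0; have ex : exists2 a, a != 0 & v = a *: gen x.
  move: vx; rewrite line_genE => /vlineP[a vE]; exists a => //.
  by apply: contraNneq v0 => a0; rewrite vE a0 scale0r.
have trZ (b : K) w : (b *: w)^T = b *: w^T by apply/matrixP => i j; rewrite !mxE.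
apply: (iffP memv_addP); have [a a0 vE] := ex.
  move=> [_ /memv_imgP[u _ ->] [_ /memv_imgP[w _ ->] ->]].
  exists u, (a^-1 *: w); rewrite !lfunE /= vE trZ -scalemxAl -scalemxAr.
  by rewrite scalerA mulVf // scale1r.
move=> [u [w ->]]; exists (tensor u).
  by apply/memv_imgP; exists u; rewrite ?memvf // lfunE.
exists (w^T *m v) => //; apply/memv_imgP; exists (a *: w); rewrite ?memvf //.
by rewrite lfunE /= trZ -scalemxAl vE -scalemxAr.
Qed.

(** [tensor u] lies in v (x) N exactly when u is killed in the fibre of Q (x) N at v, so this is
    injectivity of phi on every fibre. *)
Definition fiberwise_injective : Prop :=
  forall u w v, v != 0 -> tensor u = w^T *m v -> u = 0.

Hypothesis phi_inj : fiberwise_injective.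

(** Scaling the generator to have i-th coordinate 1 makes it regular near x. Fibrewise injectivity
    then makes (u, w) |-> phi(u) + w (x) v injective at x, hence split near x by a matrix with
    regular entries: the cokernel is locally free. *)
Lemma local_coords x :
  exists (i : 'I_3) (P : P2 K -> 'M[K]_(k * 3, m + k)),
    [/\ gen x ord0 i != 0, mx_near x P,
    \forall y \near x, gen y ord0 i != 0 &
    \forall y \near x, forall u w,
      mxvec (tensor u + w^T *m ((gen y ord0 i)^-1 *: gen y)) *m P y = row_mx u w].
Proof.
have [i xi] := gen_coord_neq0 x.
pose nu y := (gen y ord0 i)^-1 *: gen y.
pose G y := col_mx (lin1_mx (mxvec \o tensor))
                   (lin1_mx (mxvec \o (mulmxr (nu y) \o @trmx K 1 k))).
have GE y u w : row_mx u w *m G y = mxvec (tensor u + w^T *m nu y).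
  by rewrite mul_row_col !mul_rV_lin1 /= linearD.
have hG : mx_near x G.
  move=> a b; rewrite /G; case/mxvec_indexP: b => l j.
  case: (split_ordP a) => c -> /=.
    under eq_fun => y do rewrite col_mxEu; exact: regular_near_const.
  under eq_fun => y do rewrite col_mxEd mxE /= mxvecE mxE.
  apply: regular_near_sum => r _.
  apply: regular_nearM; first exact: regular_near_const.
  rewrite (ord1 r); under eq_fun => y do rewrite mxE mulrC.
  exact: regular_near_ratio.
have freeG : row_free (G x).
  rewrite -kermx_eq0; apply/eqP/row_matrixP => r; rewrite row0.
  have : row r (kermx (G x)) *m G x = 0 by rewrite -row_mul mulmx_ker row0.
  rewrite -[row r _]hsubmxK GE => /eqP; rewrite mxvec_eq0 addrC addr_eq0 => /eqP E.
  have nu0 : nu x != 0 by rewrite scaler_eq0 invr_eq0 (negPf xi) gen_neq0.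
  have u0 : lsubmx (row r (kermx (G x))) = 0.
    by apply: (phi_inj nu0 (w := - rsubmx (row r (kermx (G x)))));
       rewrite linearN mulNmx E opprK.
  move: E; rewrite u0 linear0 oppr0 => E.
  suff -> : rsubmx (row r (kermx (G x))) = 0 by rewrite row_mx0.
  apply/rowP => c; rewrite [RHS]mxE; apply/eqP.
  have /matrixP/(_ c i) := E; rewrite mxE big_ord1 !mxE mulVf // mulr1.
  by move=> /eqP.
have [P hP PG] := mx_near_left_inverse hG freeG.
exists i, P; split=> //.
  have rr := regular_near_ratio i xi.
  have : gen x ord0 i / gen x ord0 i != 0 by rewrite divff // oner_eq0.
  move=> /regular_near_neq0/(_ rr); apply: filterS => y.
  by apply: contraNneq => ->; rewrite mul0r.
move: PG; apply: filterS => y PG u w.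
by rewrite -GE -mulmxA PG mulmx1.
Qed.

Lemma fiber_sub_coords x : exists2 P : P2 K -> 'M[K]_(k * 3, m + k), mx_near x P &
  \forall y \near x, forall g, g \in fiber_sub y ->
    exists w, g = tensor (lsubmx (mxvec g *m P y)) + w^T *m gen y.
Proof.
have [i [P [xi hP yi PE]]] := local_coords x; exists P => //.
apply: (near_and yi PE) => y yi0 PyE g.
have nu0 : (gen y ord0 i)^-1 *: gen y != 0.
  by rewrite scaler_eq0 invr_eq0 (negPf yi0) gen_neq0.
have nuy : (gen y ord0 i)^-1 *: gen y \in line y by rewrite memvZ ?gen_mem.
move=> /(fiber_subP _ nuy nu0)[u [w ->]]; rewrite PyE row_mxKl.
exists ((gen y ord0 i)^-1 *: w); congr (_ + _).
by apply/matrixP => l j; rewrite !mxE !big_ord1 !mxE mulrCA mulrA.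
Qed.

(** Near x, [g y] lies in H_y exactly when it equals its reconstruction from the local coordinates.
    The difference [e] has regular entries, so its vanishing on a nonempty open set reaches x.
    Torsion-freeness and the extension of generic identities rest on this. *)
Lemma fiber_sub_closed x (D : set (P2 K)) (g : P2 K -> 'M[K]_(k, 3)) :
  open D -> D !=set0 -> mx_near x g ->
  (\forall y \near x, D y -> g y \in fiber_sub y) -> g x \in fiber_sub x.
Proof.
move=> oD D0 hg gD; have [i [P [xi hP yi PE]]] := local_coords x.
pose nu y := (gen y ord0 i)^-1 *: gen y.
have [c hc cE] : exists2 c, mx_near x c & forall y, c y = mxvec (g y) *m P y.
  exists (fun y => mxvec (g y) *m P y) =>
    //; apply: mx_nearM hP => a b; case/mxvec_indexP: b => l j.
  by rewrite (ord1 a); under eq_fun => y do rewrite mxvecE; apply: hg.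
pose e y := g y - (tensor (lsubmx (c y)) + (rsubmx (c y))^T *m nu y).
have nu0 y : gen y ord0 i != 0 -> nu y != 0.
  by move=> y0; rewrite scaler_eq0 invr_eq0 (negPf y0) gen_neq0.
have nuy y : nu y \in line y by rewrite memvZ ?gen_mem.
have he : mx_near x e.
  move=> l j; under eq_fun => y do rewrite !mxE big_ord1 !mxE.
  apply: regular_nearD; first exact: hg.
  under eq_fun => y do rewrite -mulN1r.
  apply: regular_nearM; first exact: regular_near_const.
  apply: regular_nearD.
    apply: regular_near_sum => r _; under eq_fun => y do rewrite mxE.
    by apply: regular_nearM (hc _ _) _; apply: regular_near_const.
  apply: regular_nearM (hc _ _) _.
  by under eq_fun => y do rewrite mulrC; apply: regular_near_ratio.
suff ex0 : e x = 0.
  apply/(fiber_subP _ (nuy x) (nu0 x xi)); exists (lsubmx (c x)), (rsubmx (c x)).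
  by apply/eqP; rewrite -subr_eq0; apply/eqP.
apply/matrixP => l j; rewrite [RHS]mxE.
apply: (regular_near_eq0 oD D0 (he l j)).
have nP := near_conj yi PE.
apply: (near_and nP gD) => y [yi0 PyE] gyD Dy.
have /(fiber_subP _ (nuy y) (nu0 y yi0))[u [w gE]] := gyD Dy.
by rewrite /e cE gE PyE row_mxKl row_mxKr subrr mxE.
Qed.

End Tensor.

(** * The cokernel sheaf *)

Section QuotientSheaf.
Context (K : closedFieldType) (k : nat).
Variable H : P2 K -> {vspace 'M[K]_(k, 3)}.
Implicit Types (x : P2 K) (U W : opens K) (g : P2 K -> 'M[K]_(k, 3)).

(* As for Q, the quotient by H y is modelled on the complement of H y. *)
Definition quot_class y (a : 'M[K]_(k, 3)) : 'M[K]_(k, 3) := a - projv (H y) a.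

Lemma quot_class_eq0 y a : quot_class y a = 0 <-> a \in H y.
Proof.
rewrite /quot_class; split=> [/eqP|ay]; last by rewrite projv_id ?subrr.
by rewrite subr_eq0 => /eqP->; apply: memv_proj.
Qed.

Fact quot_class_linear y : linear (quot_class y).
Proof.
by move=> c a b; rewrite /quot_class linearP /= scalerBr opprD addrACA.
Qed.

HB.instance Definition _ y :=
  GRing.isLinear.Build K 'M[K]_(k, 3) 'M[K]_(k, 3) _ (quot_class y)
    (quot_class_linear y).

Lemma eq_quot_class y a b : quot_class y a = quot_class y b <-> a - b \in H y.
Proof.
by rewrite -quot_class_eq0 [quot_class y (_ - _)]linearB /=; split=> [->|/eqP];
   [rewrite subrr | rewrite subr_eq0 => /eqP].
Qed.

Lemma quot_classK y a : a - quot_class y a \in H y.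
Proof. by rewrite /quot_class opprB addrC subrK memv_proj. Qed.

Definition lifts x g U (s : set_type (pts U) -> 'M[K]_(k, 3)) : Prop :=
  mx_near x g /\
  \forall y \near x, forall h : pts U y, s (mkpt h) = quot_class y (g y).

Definition quot_regular U (s : set_type (pts U) -> 'M[K]_(k, 3)) : Prop :=
  forall x, pts U x -> exists g, lifts x g s.

Definition quot_regular_pred U : {pred (set_type (pts U) -> 'M[K]_(k, 3))} :=
  fun s => `[< quot_regular s >].

Lemma quot_regular_const U (a : 'M[K]_(k, 3)) :
  quot_regular (fun y : set_type (pts U) => quot_class (val y) a).
Proof.
move=> x _; exists (fun=> a); split; first exact: mx_near_const.
exact: (@filterE _ (nbhs x)).
Qed.

Lemma quot_regular_res U W (h : pts W `<=` pts U)
    (s : set_type (pts U) -> 'M[K]_(k, 3)) :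
  quot_regular s -> quot_regular (s \o incl h).
Proof.
move=> hs x Wx; have [g [hg gE]] := hs x (h x Wx); exists g; split=> //.
move: gE; apply: filterS => y E Wy; rewrite -(E (h y Wy)) /=.
by congr s; apply: set_type_eq.
Qed.

Lemma mx_nearB x a b (A B : P2 K -> 'M[K]_(a, b)) :
  mx_near x A -> mx_near x B -> mx_near x (fun y => A y - B y).
Proof.
move=> hA hB i j; under eq_fun => y do rewrite !mxE -mulN1r.
apply: regular_nearD; first exact: hA.
by apply: regular_nearM (hB i j); apply: regular_near_const.
Qed.

Lemma quot_regularB U (s t : set_type (pts U) -> 'M[K]_(k, 3)) :
  quot_regular s -> quot_regular t -> quot_regular (s - t).
Proof.
move=> hs ht x Ux; have [f [hf fE]] := hs x Ux; have [g [hg gE]] := ht x Ux.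
exists (fun y => f y - g y); split; first exact: mx_nearB.
apply: (near_and fE gE) => y Es Et h.
by rewrite -[LHS]/(s (mkpt h) - t (mkpt h)) Es Et [RHS]linearB.
Qed.

Lemma quot_regularZ U (f : regfun U) (s : set_type (pts U) -> 'M[K]_(k, 3)) :
  quot_regular s -> quot_regular (fun y : set_type (pts U) => Ofun f y *: s y).
Proof.
move=> hs x Ux; have [g [hg gE]] := hs x Ux.
exists (fun y => extend0 (Ofun f) y *: g y); split.
  move=> i j; under eq_fun => y do rewrite mxE.
  by apply: regular_nearM (hg i j); apply: regular_near_extend0.
move: gE; apply: filterS => y E h.
by rewrite E [RHS]linearZ /= -[y in extend0 _ y]/(val (mkpt h)) extend0E.
Qed.

Lemma quot_regular_zmod U : zmod_closed (@quot_regular_pred U).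
Proof.
split; last first.
  by move=> s t /asboolP hs /asboolP ht; apply/asboolP/quot_regularB.
apply/asboolP; have := @quot_regular_const U 0.
by congr quot_regular; apply: funext => y; rewrite linear0.
Qed.

Record quot_sec U : Type := MkQuot {
  quot_fun :> set_type (pts U) -> 'M[K]_(k, 3);
  quot_funP : quot_fun \in @quot_regular_pred U }.

HB.instance Definition _ U := [isSub for @quot_fun U].
HB.instance Definition _ U := [Choice of quot_sec U by <:].
HB.instance Definition _ U :=
  GRing.SubChoice_isSubZmodule.Build _ (@quot_regular_pred U) (quot_sec U)
    (@quot_regular_zmod U).

Lemma quot_eq U (s t : quot_sec U) :
  (forall y, quot_fun s y = quot_fun t y) -> s = t.
Proof. by move=> h; apply: val_inj; apply: funext. Qed.

Lemma quot_sec_regular U (s : quot_sec U) : quot_regular (quot_fun s).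
Proof. exact/asboolP/quot_funP. Qed.

Definition quot_sec_of U (s : set_type (pts U) -> 'M[K]_(k, 3))
    (hs : quot_regular s) : quot_sec U :=
  MkQuot (introT (asboolP _) hs).

Definition quot_scale U (f : regfun U) (s : quot_sec U) : quot_sec U :=
  quot_sec_of (quot_regularZ f (quot_sec_regular s)).

Fact quot_scaleA U (f g : regfun U) s :
  quot_scale f (quot_scale g s) = quot_scale (f * g) s.
Proof. by apply: quot_eq => y; apply: scalerA. Qed.
Fact quot_scale1 U : left_id 1 (@quot_scale U).
Proof. by move=> s; apply: quot_eq => y; apply: scale1r. Qed.
Fact quot_scaleDr U : right_distributive (@quot_scale U) +%R.
Proof. by move=> f s t; apply: quot_eq => y; apply: scalerDr. Qed.
Fact quot_scaleDl U (s : quot_sec U) : {morph (@quot_scale U)^~ s : f g / f + g}.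
Proof. by move=> f g; apply: quot_eq => y; apply: scalerDl. Qed.

HB.instance Definition _ U :=
  GRing.Zmodule_isLmodule.Build (regfun U) (quot_sec U)
    (@quot_scaleA U) (@quot_scale1 U) (@quot_scaleDr U) (@quot_scaleDl U).

Definition quot_res U W (h : pts W `<=` pts U) (s : quot_sec U) : quot_sec W :=
  quot_sec_of (quot_regular_res h (quot_sec_regular s)).

Definition quot_const U (a : 'M[K]_(k, 3)) : quot_sec U :=
  quot_sec_of (@quot_regular_const U a).

Lemma quot_glue (I : Type) U (W : I -> opens K)
    (h : forall i, pts (W i) `<=` pts U) (s : forall i, quot_sec (W i)) :
  pts U `<=` \bigcup_i pts (W i) ->
  (forall i j,
    quot_res (W := opensI (W i) (W j)) (@subIsetl _ _ _) (s i) =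
    quot_res (W := opensI (W i) (W j)) (@subIsetr _ _ _) (s j)) ->
  exists! t : quot_sec U, forall i, quot_res (h i) t = s i.
Proof.
move=> cov agree.
have [i j y z yz|f fE] := @glue_fun _ _ _ _ _ h (fun i => quot_fun (s i)) cov.
  have Wz : (pts (W i) `&` pts (W j)) (\val y).
    by split; [exact: set_valP | rewrite yz; exact: set_valP].
  set w : set_type (pts (opensI (W i) (W j))) := mkpt Wz.
  have -> : y = incl (@subIsetl _ _ _) w by exact: set_type_eq.
  have -> : z = incl (@subIsetr _ _ _) w by exact: set_type_eq.
  have := congr1 (fun g : quot_sec (opensI (W i) (W j)) => quot_fun g w) (agree i j).
  exact.
have fr : quot_regular f.
  move=> x Ux; have [i _ Wx] := cov _ Ux.
  have [g [hg gE]] := quot_sec_regular (s i) Wx; exists g; split=> //.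
  have Wi : \forall y \near x, pts (W i) y by apply/near_opens; exists (W i).
  apply: (near_and Wi gE) => y Wy E Uy; rewrite -(E Wy) -fE.
  by congr f; apply: set_type_eq.
exists (quot_sec_of fr); split=> [i|t tE].
  by apply: quot_eq => y; apply: fE.
apply: quot_eq => x; have [i _ Wx] := cov _ (set_valP x).
have -> : x = incl (h i) (mkpt Wx) by exact: set_type_eq.
by rewrite [LHS]fE -tE.
Qed.

Definition quot_omod : omod K.
Proof.
refine (@OMod K (quot_sec : forall U, lmodType (regfun U)) quot_res
  _ _ _ _ quot_glue).
- by move=> U W h s t; apply: quot_eq.
- by move=> U W h f s; apply: quot_eq.
- move=> U h s; apply: quot_eq => y.
  rewrite -[LHS]/(quot_fun s (incl h y)).
  by congr (quot_fun s _); apply: set_type_eq.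
- move=> U W A h h' h'' s; apply: quot_eq => y.
  rewrite -[LHS]/(quot_fun s (incl h (incl h' y))).
  rewrite -[RHS]/(quot_fun s (incl h'' y)).
  by congr (quot_fun s _); apply: set_type_eq.
Defined.

End QuotientSheaf.

(** * The quotient sheaf as the cokernel of phi, and its torsion *)

Section Cokernel.
Context (K : closedFieldType) (m k : nat).
Variable phi : 'Hom('M[K]_(3, m), 'rV[K]_k).
Implicit Types (x : P2 K) (U W : opens K).

Lemma qsec_lift U (s : qsec U) x : pts U x -> exists g : P2 K -> 'rV[K]_3,
  mx_near x g /\ \forall y \near x, forall h : pts U y,
    Qfun s (mkpt h) = qclass (line y) (g y).
Proof.
move=> Ux; have [W [h [g [Wx gE]]]] := QfunP s (mkpt Ux).
exists (fun y => \row_i extend0 (Ofun (g i)) y); split.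
  move=> i j; under eq_fun => y do rewrite mxE.
  exact: regular_near_extend0.
apply/near_opens; exists W; split=> // y Wy Uy.
have -> : mkpt Uy = incl h (mkpt Wy) by apply: set_type_eq.
rewrite gE; congr (qclass _ _); apply/rowP => i; rewrite !mxE.
by rewrite -[y in RHS]/(val (mkpt Wy)) extend0E.
Qed.

Lemma qsec_of_proof U (g : 'I_3 -> regfun U) :
  qregular (fun y : set_type (pts U) => qclass (line (val y)) (\row_i g i y)).
Proof.
move=> x; exists U, (@subset_refl _ _), g; split=> [|y]; first exact: set_valP.
by rewrite (_ : incl _ y = y) //; apply: set_type_eq.
Qed.

Definition qsec_of U (g : 'I_3 -> regfun U) : qsec U :=
  MkQ (introT (asboolP _) (qsec_of_proof g)).

Lemma eq_qclass (L : {vspace 'rV[K]_3}) u v :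
  qclass L u = qclass L v <-> u - v \in L.
Proof.
by rewrite -qclass_eq0 qclassB; split=> [->|/eqP];
   [rewrite subrr | rewrite subr_eq0 => /eqP].
Qed.

Lemma qclassK (L : {vspace 'rV[K]_3}) v : qclass L v - v \in L.
Proof. by rewrite /qclass addrAC subrr sub0r memvN memv_proj. Qed.

Lemma rows_in_line x (a : 'M[K]_(k, 3)) :
  (forall l, row l a \in line x) -> exists w : 'rV[K]_k, a = w^T *m gen x.
Proof.
move=> ax; have /choice[w wE] l : exists c, row l a = c *: gen x.
  by have := ax l; rewrite line_genE => /vlineP.
exists (\row_l w l); apply/matrixP => l i.
by have /rowP/(_ i) := wE l; rewrite !mxE big_ord1 !mxE.
Qed.

Lemma rows_in_fiber_sub x (a : 'M[K]_(k, 3)) :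
  (forall l, row l a \in line x) -> a \in fiber_sub phi x.
Proof.
move=> /rows_in_line[w ->]; apply/(fiber_subP _ _ (gen_mem x) (gen_neq0 x)).
by exists 0, w; rewrite linear0 add0r.
Qed.

Lemma Qfun_sum U (I : Type) (r : seq I) (F : I -> qsec U) (y : set_type (pts U)) :
  Qfun (\sum_(i <- r) F i) y = \sum_(i <- r) Qfun (F i) y.
Proof. by elim: r => [|i r IH]; rewrite ?big_nil // !big_cons -IH. Qed.

Lemma bundle_mapE U (f : power (O_omod K) m U) l (y : set_type (pts U)) :
  Qfun ((bundle_map phi U f : {ffun 'I_k -> qsec U}) l) y =
  qclass (line (val y)) (row l (tensor phi (\row_j Ofun (f j) y))).
Proof.
rewrite ffunE Qfun_sum row_tensor.
have add : {morph qclass (line (val y)) : a b / a + b}.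
  by move=> a b; rewrite -[b]opprK !qclassB -[- - b]sub0r
    [qclass _ (0 - _)]qclassB /qclass linear0 subrr sub0r.
rewrite (big_morph _ add (_ : _ = 0)); last by rewrite /qclass linear0 subrr.
by apply: eq_bigr => j _; rewrite qclassZ mxE.
Qed.

Definition qmatrix U (s : {ffun 'I_k -> qsec U}) (y : set_type (pts U)) :
  'M[K]_(k, 3) := \matrix_l Qfun (s l) y.

Lemma qmatrix_lift U (s : {ffun 'I_k -> qsec U}) x : pts U x ->
  exists2 g : P2 K -> 'M[K]_(k, 3), mx_near x g &
  \forall y \near x, forall (h : pts U y) l,
    Qfun (s l) (mkpt h) = qclass (line y) (row l (g y)).
Proof.
move=> Ux; have /choice[g gP] l := qsec_lift (s l) Ux.
exists (fun y => \matrix_l g l y).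
  by move=> l i; under eq_fun => y do rewrite mxE; have [+ _] := gP l; apply.
have : \forall y \near x, forall l (h : pts U y),
    Qfun (s l) (mkpt h) = qclass (line y) (g l y).
  by apply: (@filter_forall _ _ _ (nbhs x)) => l; have [] := gP l.
by apply: filterS => y E h l; rewrite rowK.
Qed.

(** A section of Q stores a representative in the complement of the line; passing to another lift
    changes each row by an element of the line, and such matrices lie in H_y. *)
Lemma quot_class_qmatrix U (s : {ffun 'I_k -> qsec U}) (y : set_type (pts U))
    (a : 'M[K]_(k, 3)) :
  (forall l, Qfun (s l) y = qclass (line (val y)) (row l a)) ->
  quot_class (fiber_sub phi) (val y) (qmatrix s y) =
  quot_class (fiber_sub phi) (val y) a.
Proof.
move=> E; apply/eq_quot_class/rows_in_fiber_sub => l.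
by rewrite linearB /= rowK E qclassK.
Qed.

Lemma coker_fun_regular U (s : {ffun 'I_k -> qsec U}) :
  quot_regular (fiber_sub phi)
    (fun y => quot_class (fiber_sub phi) (val y) (qmatrix s y)).
Proof.
move=> x Ux; have [g hg gE] := qmatrix_lift s Ux; exists g; split=> //.
by move: gE; apply: filterS => y E h; apply: (@quot_class_qmatrix _ _ (mkpt h)).
Qed.

Definition coker_fun U (s : power (Q_omod K) k U) :
    quot_omod (fiber_sub phi) U :=
  quot_sec_of (coker_fun_regular s).

Fact coker_fun_linear U : linear (@coker_fun U).
Proof.
move=> f s t; apply: quot_eq => y.
rewrite -[RHS]/(Ofun f y *: quot_class (fiber_sub phi) (val y) (qmatrix s y) +
                quot_class (fiber_sub phi) (val y) (qmatrix t y)).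
rewrite -linearP; congr (quot_class _ _ _).
by apply/row_matrixP => l; rewrite linearP /= !rowK !ffunE.
Qed.

HB.instance Definition _ U :=
  GRing.isLinear.Build (regfun U) (power (Q_omod K) k U)
    (quot_omod (fiber_sub phi) U) _ (@coker_fun U) (@coker_fun_linear U).

Definition coker_map : omor (power (Q_omod K) k) (quot_omod (fiber_sub phi)).
Proof.
refine (@OMor K _ _ (fun U => @coker_fun U) _).
move=> U W h s; apply: quot_eq => y; congr (quot_class _ _ _).
by apply/row_matrixP => l; rewrite !rowK ffunE.
Defined.

Hypothesis phi_inj : fiberwise_injective phi.

Lemma bundle_map_injective : injective_omor (bundle_map phi).
Proof.
move=> U f f' E; apply/ffunP => j; apply: O_eq => y.
pose u : 'rV[K]_m := \row_j Ofun (f j) y; pose u' : 'rV[K]_m := \row_j Ofun (f' j) y.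
suff : u - u' = 0 by move=> /rowP/(_ j); rewrite !mxE => /eqP; rewrite subr_eq0 => /eqP.
have [l|w wE] := @rows_in_line (val y) (tensor phi (u - u')).
  rewrite !linearB /= -/u; apply/eq_qclass.
  by rewrite -!bundle_mapE E.
exact: phi_inj (gen_neq0 (val y)) wE.
Qed.

(** For the kernel, a lift of s takes values in H, and its M-coordinate given by [fiber_sub_coords]
    is regular near x; phi maps it to s, since the rest of the lift lies in v (x) N. *)
Lemma coker_map_is_coker : is_coker (bundle_map phi) coker_map.
Proof.
split=> [U t x Ux|U s].
  have [g [hg gE]] := quot_sec_regular t Ux.
  have := @regular_near_regfun K _ x
    (fun (li : 'I_k * 'I_3) y => g y li.1 li.2) _ (fun li => hg li.1 li.2).
  have Un : \forall y \near x, pts U y by apply/near_opens; exists U.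
  move=> /(_ _ (near_conj Un gE))[W [r [Wx WU rE]]].
  have h : pts W `<=` pts U by move=> y /WU[].
  exists W, h, [ffun l => qsec_of (fun i => r (l, i))]; split=> //.
  apply: quot_eq => y.
  have [_ /(_ (h _ (set_valP y))) tE] := WU _ (set_valP y).
  rewrite [RHS](_ : _ = quot_fun t (mkpt (h _ (set_valP y)))); last first.
    by congr (quot_fun t _); apply: set_type_eq.
  rewrite tE; apply: quot_class_qmatrix => l; rewrite ffunE.
  by congr (qclass _ _); apply/rowP => i; rewrite !mxE rE.
split=> [s0 x Ux|loc]; last first.
  apply: quot_eq => y; have [W [h [r [Wy rE]]]] := loc _ (set_valP y).
  apply/quot_class_eq0.
  suff sE l : Qfun ((s : {ffun 'I_k -> qsec U}) l) y =
      qclass (line (val y)) (row l (tensor phi (\row_j Ofun (r j) (mkpt Wy)))).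
    have := quot_class_qmatrix sE => /eq_quot_class.
    rewrite -[X in X \in _ -> _]opprB memvN => h1.
    have h2 : tensor phi (\row_j Ofun (r j) (mkpt Wy)) \in fiber_sub phi (val y).
      apply/(fiber_subP _ _ (gen_mem _) (gen_neq0 _)).
      by exists (\row_j Ofun (r j) (mkpt Wy)), 0; rewrite trmx0 mul0mx addr0.
    by have := memvB h2 h1; rewrite opprB addrC subrK.
  have := bundle_mapE r l (mkpt Wy); rewrite rE ffunE => <-.
  rewrite -[RHS]/(Qfun ((s : {ffun 'I_k -> qsec U}) l) (incl h (mkpt Wy))).
  by congr (Qfun _ _); apply: set_type_eq.
have [g hg gE] := qmatrix_lift s Ux.
have [P hP PE] := fiber_sub_coords phi_inj x.
have hu : mx_near x (fun y => lsubmx (mxvec (g y) *m P y)).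
  move=> i j; under eq_fun => y do rewrite mxE.
  apply: mx_nearM hP _ _ => a b; case/mxvec_indexP: b => l c.
  by rewrite (ord1 a); under eq_fun => y do rewrite mxvecE; apply: hg.
have Un : \forall y \near x, pts U y by apply/near_opens; exists U.
have nP := near_conj (near_conj Un gE) PE.
have [W [r [Wx WP rE]]] := regular_near_regfun (fun j => hu ord0 j) nP.
have h : pts W `<=` pts U by move=> y /WP[[]].
exists W, h, [ffun j => r j]; split=> //.
apply/ffunP => l; apply: Q_eq => y; rewrite bundle_mapE ffunE.
have [[Uy /(_ Uy) sE] /(_ (g (val y)))] := WP _ (set_valP y).
have gH : g (val y) \in fiber_sub phi (val y).
  have gs := quot_class_qmatrix (y := mkpt Uy) sE.
  apply/(quot_class_eq0 (fiber_sub phi) (val y)).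
  rewrite -[LHS]gs.
  by have := congr1 (fun t : quot_sec _ U => quot_fun t (mkpt Uy)) s0.
move=> /(_ gH)[w gwE].
rewrite -[RHS]/(Qfun ((s : {ffun 'I_k -> qsec U}) l) (incl h y)).
have -> : incl h y = mkpt Uy by apply: set_type_eq.
rewrite sE [in RHS]gwE; apply/eq_qclass.
have -> : \row_j Ofun ([ffun j => r j] j) y = lsubmx (mxvec (g (val y)) *m P (val y)).
  by apply/rowP => j; rewrite mxE ffunE rE.
rewrite [row l (_ + _)]linearD /= opprD addrA subrr sub0r memvN.
have -> : row l (w^T *m gen (val y)) = w ord0 l *: gen (val y).
  by apply/rowP => i; rewrite !mxE big_ord1 !mxE.
by rewrite memvZ ?gen_mem.
Qed.

(** Where f is nonzero, the relation f s = 0 puts the lifts of s in H; if f is not 0, this happens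
    on a nonempty open set, and [fiber_sub_closed] gives it everywhere. *)
Lemma quot_torsion_free : torsion_free (quot_omod (fiber_sub phi)).
Proof.
move=> U f s fs0; have [->|f0] := pselect (f = 0); [by left | right].
have [y1 fy1] : exists y1, Ofun f y1 != 0.
  apply: contrapT => h; apply: f0; apply: O_eq => y.
  by apply: contrapT => /eqP fy; apply: h; exists y.
have Uy1 := set_valP y1; set z := val y1 in Uy1.
have zn : extend0 (Ofun f) z != 0 by rewrite extend0E.
have fz := regular_near_neq0 zn (regular_near_extend0 f Uy1).
have Un : \forall y \near z, pts U y by apply/near_opens; exists U.
have /near_opens[D [Dz DP]] := near_conj Un fz.
apply: quot_eq => x; have Ux := set_valP x.
have [g [hg gE]] := quot_sec_regular s Ux.
have xE : mkpt Ux = x by apply: set_type_eq.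
rewrite -[in LHS]xE (nbhs_singleton gE); apply/(quot_class_eq0 (fiber_sub phi)).
apply: (fiber_sub_closed phi_inj (opens_open D) _ hg); first by exists z.
move: gE; apply: filterS => y sE Dy; have [Uy fy] := DP y Dy.
apply/(quot_class_eq0 (fiber_sub phi)); rewrite -(sE Uy).
have := congr1 (fun t : quot_sec _ U => quot_fun t (mkpt Uy)) fs0.
rewrite -[LHS]/(Ofun f (mkpt Uy) *: quot_fun s (mkpt Uy)) => /eqP.
have fE := extend0E (Ofun f) (mkpt Uy).
by rewrite scaler_eq0 -fE (negPf fy) => /eqP.
Qed.

End Cokernel.

(** * Endomorphisms of the cokernel *)

Section Endomorphisms.
Context (K : closedFieldType) (m k : nat).
Variable phi : 'Hom('M[K]_(3, m), 'rV[K]_k).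
Implicit Types (x : P2 K) (U W : opens K) (a : 'M[K]_(k, 3)).

Definition allP2 : opens K := Opens (@openT (P2 K)).

Local Notation H := (fiber_sub phi).

Lemma quot_fun_sum U (I : Type) (r : seq I) (F : I -> quot_sec H U)
    (y : set_type (pts U)) :
  quot_fun (\sum_(i <- r) F i) y = \sum_(i <- r) quot_fun (F i) y.
Proof. by elim: r => [|i r IH]; rewrite ?big_nil // !big_cons -IH. Qed.

(** Constant sections generate the quotient sheaf: near x, s is the combination of the constants
    [delta_mx] whose coefficients are the entries of g. Since e is O-linear and commutes with
    restriction, its values on global constants determine it. *)
Lemma omor_lifts (e : omor (quot_omod H) (quot_omod H))
    (E : {linear 'M[K]_(k, 3) -> 'M[K]_(k, 3)}) :
  (forall a, e allP2 (quot_const H allP2 a) = quot_const H allP2 (E a)) ->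
  forall U (s : quot_sec H U) x (Ux : pts U x) g, lifts H x g (quot_fun s) ->
  quot_fun (e U s) (mkpt Ux) = quot_class H x (E (g x)).
Proof.
move=> eE U s x Ux g [hg gE].
have Un : \forall y \near x, pts U y by apply/near_opens; exists U.
have [W [r [Wx WP rE]]] := regular_near_regfun
  (f := fun (li : 'I_k * 'I_3) y => g y li.1 li.2) (fun li => hg li.1 li.2)
  (near_conj Un gE).
have h : pts W `<=` pts U by move=> y /WP[].
have hT : pts W `<=` pts allP2 by [].
have eW a : e W (quot_const H W a) = quot_const H W (E a).
  have rc b : quot_const H W b = res (o := quot_omod H) hT (quot_const H allP2 b).
    exact: quot_eq.
  by rewrite rc morN eE -rc.
have sE : res (o := quot_omod H) h s =
    \sum_li r li *: (quot_const H W (delta_mx li.1 li.2) : quot_omod H W).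
  apply: quot_eq => y; have [Uy /(_ Uy) sy] := WP _ (set_valP y).
  have -> : quot_fun (res (o := quot_omod H) h s) y = quot_fun s (mkpt Uy).
    by rewrite -[LHS]/(quot_fun s (incl h y)); congr (quot_fun s _);
       apply: set_type_eq.
  rewrite sy quot_fun_sum {1}(matrix_sum_delta (g (val y))) pair_big linear_sum /=.
  by apply: eq_bigr => li _; rewrite linearZ /= -rE.
have := morN e h s; rewrite sE linear_sum => /(congr1 (fun t : quot_sec H W =>
  quot_fun t (mkpt Wx))).
rewrite -[X in _ = X -> _]/(quot_fun (e U s) (incl h (mkpt Wx))).
have -> : incl h (mkpt Wx) = mkpt Ux by apply: set_type_eq.
move=> <-; rewrite quot_fun_sum [in RHS](matrix_sum_delta (g x)) pair_big.
rewrite !linear_sum /=; apply: eq_bigr => li _.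
have rx : r li (mkpt Wx) = g x li.1 li.2 := rE li (mkpt Wx).
by rewrite linearZ eW !linearZ /= -rx.
Qed.

(** An element of [H x] extends to a regular g with values in H; such a g lifts the zero section,
    which e maps to zero. *)
Lemma omor_stabilizes (e : omor (quot_omod H) (quot_omod H))
    (E : {linear 'M[K]_(k, 3) -> 'M[K]_(k, 3)}) :
  (forall a, e allP2 (quot_const H allP2 a) = quot_const H allP2 (E a)) ->
  forall x a, a \in H x -> E a \in H x.
Proof.
move=> eE x a /(fiber_subP _ _ (gen_mem x) (gen_neq0 x))[u [w ->]].
have [i xi] := gen_coord_neq0 x.
(* The scaling makes the second term regular in y without changing its value at x. *)
pose g y := tensor phi u + (gen x ord0 i / gen y ord0 i) *: (w^T *m gen y).
have gx : g x = tensor phi u + w^T *m gen x by rewrite /g divff // scale1r.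
have hg : lifts H x g (quot_fun (0 : quot_sec H allP2)).
  split; last first.
    apply: (@filterE _ (nbhs x)) => y h; rewrite -[LHS]/(0 : 'M[K]_(k, 3)).
    symmetry; apply/quot_class_eq0/(fiber_subP _ _ (gen_mem y) (gen_neq0 y)).
    exists u, ((gen x ord0 i / gen y ord0 i) *: w); congr (_ + _).
    by apply/matrixP => l j; rewrite !mxE !big_ord1 !mxE mulrA.
  move=> l j; rewrite /g; under eq_fun => y do rewrite mxE.
  apply: regular_nearD; first exact: regular_near_const.
  under eq_fun => y do rewrite !mxE big_ord1 !mxE mulrCA -mulrA (mulrC _^-1).
  apply: regular_nearM; first exact: regular_near_const.
  apply: regular_nearM; first exact: regular_near_const.
  exact: regular_near_ratio.
have := omor_lifts eE (I : pts allP2 x) hg.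
by rewrite linear0 -[LHS]/(0 : 'M[K]_(k, 3)) gx => /esym/quot_class_eq0.
Qed.

(** Reduces simplicity to linear algebra: as every global section is constant, e is represented on V
    (x) N by a linear map E, and E preserves every fibre of H. *)
Lemma quot_simple :
  (forall s : quot_sec H allP2, exists a, s = quot_const H allP2 a) ->
  (forall E : {linear 'M[K]_(k, 3) -> 'M[K]_(k, 3)},
    (forall x a, a \in H x -> E a \in H x) ->
    exists c, forall x a, E a - c *: a \in H x) ->
  simple (quot_omod H).
Proof.
move=> glob scal e.
have /choice[b bE] : forall li : 'I_k * 'I_3, exists a,
    e allP2 (quot_const H allP2 (delta_mx li.1 li.2)) = quot_const H allP2 a.
  by move=> li; apply: glob.
pose E0 a : 'M[K]_(k, 3) := \sum_li a li.1 li.2 *: b li.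
have E0lin : linear E0.
  move=> c a a'; rewrite /E0 scaler_sumr -big_split; apply: eq_bigr => li _.
  by rewrite !mxE scalerDl scalerA.
pose E : {linear 'M[K]_(k, 3) -> 'M[K]_(k, 3)} :=
  HB.pack E0 (GRing.isLinear.Build K 'M[K]_(k, 3) 'M[K]_(k, 3) _ E0 E0lin).
have eE a : e allP2 (quot_const H allP2 a) = quot_const H allP2 (E a).
  have cE (a' : 'M[K]_(k, 3)) (B : 'I_k * 'I_3 -> 'M[K]_(k, 3)) :
      quot_const H allP2 (\sum_li a' li.1 li.2 *: B li) =
      \sum_li Oconst allP2 (a' li.1 li.2) *:
        (quot_const H allP2 (B li) : quot_omod H allP2).
    apply: quot_eq => y; rewrite quot_fun_sum.
    rewrite -[LHS]/(quot_class H (val y) _) linear_sum.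
    by apply: eq_bigr => li _; rewrite linearZ.
  rewrite {1}(matrix_sum_delta a) pair_big cE linear_sum -[E a]/(E0 a) cE.
  by apply: eq_bigr => li _; rewrite linearZ bE.
have [c cE] := scal E (omor_stabilizes eE); exists c => U s.
apply: quot_eq => y; have Uy := set_valP y.
have -> : y = mkpt Uy by apply: set_type_eq.
have [g hg] := quot_sec_regular s Uy; have [_ gE] := hg.
rewrite (omor_lifts eE Uy hg).
rewrite -[RHS]/(c *: quot_fun s (mkpt Uy)) (nbhs_singleton gE) -linearZ.
exact/eq_quot_class/cE.
Qed.

End Endomorphisms.

(** * Global sections of O(1) *)

Section RationalOnLines.
Context (K : closedFieldType).
Implicit Types (P Q R : {poly K}) (b c : K -> K) (t : K) (v w : 'rV[K]_3).

Definition rational_at b t0 : Prop :=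
  exists P Q, Q.[t0] != 0 /\ forall t, Q.[t] != 0 -> b t * Q.[t] = P.[t].

Lemma rational_at_horner P t0 : rational_at (fun t => P.[t]) t0.
Proof.
exists P, 1; rewrite hornerE oner_eq0; split=> // t _.
by rewrite hornerE mulr1.
Qed.

Lemma rational_atD b c t0 : rational_at b t0 -> rational_at c t0 ->
  rational_at (fun t => b t + c t) t0.
Proof.
move=> [P [Q [Q0 PE]]] [P' [Q' [Q0' PE']]].
exists (P * Q' + P' * Q), (Q * Q'); rewrite hornerM mulf_neq0 //; split=> // t.
rewrite !(hornerM, hornerD) mulf_eq0 => /norP[Qt Qt'].
by rewrite -PE // -PE' // mulrDl -!mulrA [Q.[t] * _ in X in _ + X]mulrC.
Qed.

Lemma rational_atM b c t0 : rational_at b t0 -> rational_at c t0 ->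
  rational_at (fun t => b t * c t) t0.
Proof.
move=> [P [Q [Q0 PE]]] [P' [Q' [Q0' PE']]].
exists (P * P'), (Q * Q'); rewrite hornerM mulf_neq0 //; split=> // t.
rewrite !hornerM mulf_eq0 => /norP[Qt Qt'].
by rewrite -PE // -PE' // mulrACA.
Qed.

Lemma rational_at_sum (I : Type) (r : seq I) (F : I -> K -> K) t0 :
  (forall i, rational_at (F i) t0) ->
  rational_at (fun t => \sum_(i <- r) F i t) t0.
Proof.
move=> h; elim: r => [|i r IH].
  have := rational_at_horner 0 t0; congr rational_at; apply/funext => t.
  by rewrite big_nil horner0.
have := rational_atD (h i) IH; congr rational_at; apply/funext => t.
by rewrite big_cons.
Qed.

Lemma eq_rational_at b c t0 :
  (exists2 Q, Q.[t0] != 0 & forall t, Q.[t] != 0 -> b t = c t) ->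
  rational_at b t0 -> rational_at c t0.
Proof.
move=> [Q Q0 bc] [P' [Q' [Q0' PE']]].
exists (P' * Q), (Q' * Q); rewrite hornerM mulf_neq0 //; split=> // t.
rewrite !hornerM mulf_eq0 => /norP[Qt' Qt].
by rewrite mulrA -bc // PE'.
Qed.

(* A denominator of minimal degree has no root: locally at a root, b has another
   expression, whose denominator does not vanish. *)
Lemma rational_everywhere b : (forall t0, rational_at b t0) ->
  exists R, forall t, b t = R.[t].
Proof.
move=> br.
suff main n P Q : (size Q <= n)%N -> Q != 0 ->
    (forall t, Q.[t] != 0 -> b t * Q.[t] = P.[t]) -> exists R, forall t, b t = R.[t].
  have [P [Q [Q0 PE]]] := br 0; apply: (main _ P Q (leqnn _)) => //.
  by apply: contraNneq Q0 => ->; rewrite horner0.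
elim: n P Q => [|n IH] P Q sQ Q0 PE.
  by move: sQ; rewrite leqn0 size_poly_eq0 (negPf Q0).
have [/eqP/size_poly1P[c c0 QE]|/closed_rootP[t0 Qt0]] := eqVneq (size Q) 1%N.
  exists (c^-1 *: P) => t; rewrite hornerZ -PE QE hornerC //.
  by rewrite mulrCA mulVf // mulr1.
have [P1 [Q1 [Q10 PE1]]] := br t0.
have cross : P * Q1 = P1 * Q.
  have Q1n : Q1 != 0 by apply: contraNneq Q10 => ->; rewrite horner0.
  suff : (P * Q1 - P1 * Q) * (Q * Q1) = 0.
    by move=> /eqP; rewrite !mulf_eq0 (negPf Q0) (negPf Q1n) !orbF subr_eq0 => /eqP.
  apply: poly_eq0_horner => t; rewrite !(hornerM, hornerD, hornerN).
  have [->|Qt] := eqVneq Q.[t] 0; first by rewrite mul0r mulr0.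
  have [->|Q1t] := eqVneq Q1.[t] 0; first by rewrite !mulr0.
  by rewrite -PE // -PE1 // mulrAC subrr mul0r.
have Pt0 : root P t0.
  have := congr1 (fun R => R.[t0]) cross; rewrite !hornerM (rootP Qt0) mulr0.
  by move=> /eqP; rewrite mulf_eq0 (negPf Q10) orbF.
have /factor_theorem[Q' QE] := Qt0; have /factor_theorem[P' PE'] := Pt0.
have Xn : 'X - t0%:P != 0 :> {poly K} by rewrite polyXsubC_eq0.
have Q'0 : Q' != 0 by apply: contraNneq Q0 => Q'0; rewrite QE Q'0 mul0r.
apply: (IH P' Q') => //.
  by move: sQ; rewrite QE size_Mmonic ?monicXsubC // size_XsubC addn2.
have cross' : P' * Q1 = P1 * Q'.
  by apply: (mulIf Xn); rewrite mulrAC -PE' cross QE mulrA.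
move=> t Q't; have [->|tt0] := eqVneq t t0.
  apply: (mulIf Q10); have := congr1 (fun R => R.[t0]) cross'.
  by rewrite !hornerM => ->; rewrite mulrAC PE1.
have t0n : t - t0 != 0 by rewrite subr_eq0.
apply: (mulIf t0n); have := PE t; rewrite QE PE' !hornerM !hornerXsubC mulrA.
by apply; rewrite mulf_neq0.
Qed.

Definition independent v w : Prop :=
  forall a b : K, a *: v + b *: w = 0 -> a = 0 /\ b = 0.

Lemma independentC v w : independent v w -> independent w v.
Proof. by move=> h a b; rewrite addrC => /h[]. Qed.

Lemma independent_line v w t : independent v w -> v + t *: w != 0.
Proof.
move=> h; apply/eqP; rewrite -[v]scale1r => /h[] /eqP.
by rewrite oner_eq0.
Qed.

Lemma independent_neq0 v w : independent v w -> v != 0.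
Proof. by move=> h; have := independent_line 0 h; rewrite scale0r addr0. Qed.

(** What is kept of a global section of O(1): homogeneity of degree 1 and local rationality along
    each affine line that misses the origin. The value at 0 is unconstrained, as 0 represents no
    point of the plane. *)
Definition degree1_rational (f : 'rV[K]_3 -> K) : Prop :=
  (forall (a : K) v, a != 0 -> v != 0 -> f (a *: v) = a * f v) /\
  forall v w t0, independent v w -> rational_at (fun t => f (v + t *: w)) t0.

(* f (v + t w) = R(t) and f (w + s v) = S(s) are polynomials, R(t) = t S(1/t), so
   R has degree at most 1. *)
Lemma degree1_affine f v w t : degree1_rational f -> independent v w ->
  f (v + t *: w) = f v + t * f w.
Proof.
move=> [fZ fr] vw; have wv := independentC vw.
have [R RE] := rational_everywhere (fun t0 => fr v w t0 vw).
have [S SE] := rational_everywhere (fun t0 => fr w v t0 wv).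
have RS s : s != 0 -> R.[s] = s * S.[s^-1].
  move=> s0; rewrite -RE -SE -fZ // ?independent_line //; congr f.
  by rewrite scalerDr scalerA divff // scale1r addrC.
pose d := size S.
(* This is X^d times X S(1/X). Its exponents are at most d + 1, so comparison with R X^d leaves no
   coefficient of R beyond the first. *)
pose S' : {poly K} := \sum_(i < d) S`_i *: 'X^(d.+1 - i).
have RXE : R * 'X^d = S'.
  suff : (R * 'X^d - S') * 'X = 0.
    by move=> /eqP; rewrite mulf_eq0 polyX_eq0 orbF subr_eq0 => /eqP.
  apply: poly_eq0_horner => s; rewrite hornerM hornerX.
  have [->|s0] := eqVneq s 0; first by rewrite mulr0.
  rewrite hornerD hornerN hornerM hornerXn RS // horner_coef horner_sum.
  rewrite mulr_sumr mulr_suml -sumrB big1 ?mul0r // => i _.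
  apply/eqP; rewrite subr_eq0 hornerZ hornerXn mulrCA -mulrA; apply/eqP.
  congr (_ * _); rewrite exprVn mulrAC -exprS.
  by rewrite exprB ?unitfE // ltnW // ltnS ltnW.
have Rcoef j : R`_j = \sum_(i < d) S`_i * ((d + j)%N == (d.+1 - i)%N)%:R.
  have := congr1 (fun p : {poly K} => p`_(d + j)) RXE.
  rewrite coefMXn ltnNge leq_addr /= addKn => ->; rewrite coef_sum.
  by apply: eq_bigr => i _; rewrite coefZ coefXn.
have R1 : R`_1 = S`_0.
  have [d0|d0] := posnP d.
    rewrite Rcoef big1 => [|i _]; last first.
      by have := ltn_ord i; rewrite [X in (_ < X)%N -> _]d0.
    by rewrite nth_default // -/d d0.
  rewrite Rcoef (bigD1 (Ordinal d0)) //= addn1 subn0 eqxx mulr1 big1 ?addr0 //.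
  move=> i; rewrite -val_eqE /= -lt0n => i0.
  by rewrite gtn_eqF ?mulr0 // ltn_subrL i0.
have R2 j : R`_(j.+2) = 0.
  rewrite Rcoef big1 // => i _; rewrite gtn_eqF ?mulr0 //.
  by rewrite (leq_ltn_trans (leq_subr _ _)) // !addnS !ltnS leq_addr.
have RE2 : R = (R`_0)%:P + R`_1 *: 'X.
  apply/polyP => - [ | [ | j ] ];
    rewrite coefD coefC coefZ coefX /= ?mulr0 ?mulr1 ?addr0 ?add0r //.
have -> : f v = R`_0 by rewrite -[v]addr0 -(scale0r w) RE horner_coef0.
have -> : f w = R`_1 by rewrite R1 -[w]addr0 -(scale0r v) SE horner_coef0.
by rewrite RE {1}RE2 hornerD hornerC hornerZ hornerX mulrC.
Qed.

(** Additivity on independent vectors is [degree1_affine] at t = 1, and on proportional ones it is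
    homogeneity; the extension F of f by 0 at the origin covers both cases. *)
Lemma degree1_linear f v : degree1_rational f -> v != 0 ->
  f v = \sum_i v ord0 i * f (delta_mx 0 i).
Proof.
move=> hf v0; pose F v := if v == 0 then 0 else f v.
have FZ a w : F (a *: w) = a * F w.
  rewrite /F scaler_eq0; have [->|a0] := eqVneq a 0; first by rewrite mul0r.
  by have [|w0] := eqVneq w 0; rewrite ?mulr0 //=; case: hf => ->.
have FD u w : F (u + w) = F u + F w.
  have [->|u0] := eqVneq u 0; first by rewrite /F eqxx !add0r.
  have [/vlineP[c ->]|wu] := boolP (w \in <[u]>%VS).
    by rewrite -{1}[u]scale1r -scalerDl !FZ mulrDl mul1r.
  have iuw : independent u w.
    move=> a b /eqP; rewrite addr_eq0 => /eqP abE.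
    have b0 : b = 0.
      apply: contraNeq wu => b0; apply/vlineP; exists (- (b^-1 * a)).
      by rewrite scaleNr -scalerA abE scalerN opprK scalerA mulVf // scale1r.
    split=> //; move/eqP: abE; rewrite b0 scale0r oppr0 scaler_eq0 (negPf u0) orbF.
    by move=> /eqP.
  have := degree1_affine 1 hf iuw; rewrite scale1r mul1r /F.
  rewrite (negPf u0) (negPf (independent_neq0 (independentC iuw))).
  by have := independent_line 1 iuw; rewrite scale1r => /negPf ->.
have F0 : F 0 = 0 by rewrite /F eqxx.
have -> : f v = F v by rewrite /F (negPf v0).
rewrite {1}[v]row_sum_delta (big_morph F FD F0); apply: eq_bigr => i _.
rewrite FZ /F ifN //; apply/eqP => /rowP/(_ i); rewrite !mxE !eqxx => /eqP.
by rewrite oner_eq0.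
Qed.

Lemma near_on_line v w t0 (X : P2 K -> Prop) : independent v w ->
  (\forall y \near point (v + t0 *: w), X y) ->
  exists2 Q, Q.[t0] != 0 & forall t, Q.[t] != 0 -> X (point (v + t *: w)).
Proof.
move=> vw /near_opens[W [Wx WX]].
have nz t := independent_line t vw.
have [d [h [hh hx hW]]] := open_basic (opens_open W) Wx.
exists (line_poly h v w); first by rewrite horner_line_poly hx ?mem_point.
move=> t; rewrite horner_line_poly => ht; apply: WX.
by apply: hW ht; apply: mem_point.
Qed.

Lemma regular_near_on_line v w t0 (f : P2 K -> K) : independent v w ->
  regular_near (point (v + t0 *: w)) f ->
  rational_at (fun t => f (point (v + t *: w))) t0.
Proof.
move=> vw [d [p [q [hp hq H]]]].
have nz t := independent_line t vw.
have [Q Q0 QH] := near_on_line vw H.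
exists (line_poly p v w * Q), (line_poly q v w * Q); rewrite hornerM.
have [] := nbhs_singleton H _ (mem_point (nz t0)) (nz t0).
rewrite -horner_line_poly => q0 _; rewrite mulf_neq0 //; split=> // t.
rewrite !hornerM mulf_eq0 => /norP[qt Qt].
have [] := QH t Qt _ (mem_point (nz t)) (nz t).
by rewrite -!horner_line_poly => _ ->; rewrite mulrA divfK.
Qed.

End RationalOnLines.

Section GlobalSections.
Context (K : closedFieldType) (k : nat).
Variable H : P2 K -> {vspace 'M[K]_(k, 3)}.

(* b induces a morphism from the quotient sheaf to O(1), and the global sections of
   O(1) are linear forms. *)
Lemma global_section_linear (b : 'rV[K]_3 -> 'M[K]_(k, 3) -> K)
    (s : quot_sec H (allP2 K)) :
  (forall c v v' a, b (c *: v + v') a = c * b v a + b v' a) ->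
  (forall c v a a', b v (c *: a + a') = c * b v a + b v a') ->
  (forall v a, v != 0 -> a \in H (point v) -> b v a = 0) ->
  forall v, v != 0 -> b v (quot_fun s (@mkpt _ (pts (allP2 K)) (point v) I)) =
    \sum_i v ord0 i *
      b (delta_mx 0 i)
        (quot_fun s (@mkpt _ (pts (allP2 K)) (point (delta_mx 0 i)) I)).
Proof.
move=> bl br bH v v0.
pose c i (lj : 'I_k * 'I_3) := b (delta_mx 0 i) (delta_mx lj.1 lj.2).
(* In coordinates b is a polynomial expression, hence preserves rationality along lines. *)
have bE u a : b u a = \sum_i \sum_lj c i lj * (u ord0 i * a lj.1 lj.2).
  have bl0 a' : b 0 a' = 0.
    by have := bl (-1) 0 0 a'; rewrite scaler0 addr0 mulN1r addNr.
  have br0 u' : b u' 0 = 0.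
    by have := br (-1) u' 0 0; rewrite scaler0 addr0 mulN1r addNr.
  have blD a' : {morph b^~ a' : u' u'' / u' + u''}.
    by move=> u' u''; rewrite -[u' in LHS]scale1r bl mul1r.
  have brD u' : {morph b u' : a' a'' / a' + a''}.
    by move=> a' a''; rewrite -[a' in LHS]scale1r br mul1r.
  have blZ d u' a' : b (d *: u') a' = d * b u' a'.
    by rewrite -[d *: u']addr0 bl bl0 addr0.
  have brZ d u' a' : b u' (d *: a') = d * b u' a'.
    by rewrite -[d *: a']addr0 br br0 addr0.
  rewrite {1}[u]row_sum_delta (big_morph _ (blD a) (bl0 a)); apply: eq_bigr => i _.
  rewrite blZ {1}[a]matrix_sum_delta pair_big (big_morph _ (brD _) (br0 _)) mulr_sumr.
  by apply: eq_bigr => lj _; rewrite brZ mulrA mulrC.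
pose f u := b u (quot_fun s (@mkpt _ (pts (allP2 K)) (point u) I)).
apply: (@degree1_linear K f) => //; split=> [a u a0 u0|{v0} {}v w t0 vw].
  have -> : f (a *: u) = b (a *: u) (quot_fun s (@mkpt _ (pts (allP2 K)) (point u) I)).
    rewrite /f; congr (b _ (quot_fun s _)); apply: set_type_eq => /=.
    by apply: point_mem; rewrite ?scaler_eq0 ?negb_or ?a0 // memvZ // mem_point.
  rewrite /f !bE mulr_sumr; apply: eq_bigr => i _; rewrite mulr_sumr.
  by apply: eq_bigr => lj _; rewrite mxE !mulrA [c _ _ * a]mulrC.
have bB u a a' : b u (a - a') = b u a - b u a'.
  rewrite !bE -sumrB; apply: eq_bigr => i _; rewrite -sumrB.
  by apply: eq_bigr => lj _; rewrite !mxE !mulrBr.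
have [g [hg gE]] := quot_sec_regular s (I : pts (allP2 K) (point (v + t0 *: w))).
have [Q Q0 QE] := near_on_line vw gE.
(* The section and its lift g differ by an element of H, on which b vanishes. *)
apply: (@eq_rational_at K (fun t => b (v + t *: w) (g (point (v + t *: w))))).
  exists Q => // t Qt; rewrite /f QE //; apply/eqP; rewrite -subr_eq0 -bB bH //.
    exact: independent_line.
  exact: quot_classK.
have := @rational_at_sum _ _ (index_enum 'I_3) (fun i t => \sum_lj
  c i lj * ((v + t *: w) ord0 i * g (point (v + t *: w)) lj.1 lj.2)) t0.
move=> h; under [X in rational_at X _]eq_fun => t do rewrite bE.
apply: h => i; apply: rational_at_sum => lj.
apply: rational_atM.
  by have := rational_at_horner (c i lj)%:P t0; congr rational_at;
     apply/funext => t; rewrite hornerC.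
apply: rational_atM; last exact: regular_near_on_line vw (hg lj.1 lj.2).
have := rational_at_horner ((v ord0 i)%:P + (w ord0 i)%:P * 'X) t0.
by congr rational_at; apply/funext => t; rewrite !hornerE !mxE mulrC.
Qed.

End GlobalSections.

(** * The morphism phi *)

Section PolynomialPairs.
Context (K : closedFieldType) (a b : nat).
Implicit Types (w : 'rV[K]_(a + b)) (p r : {poly K}).

(* A vector of K^(a + b) is a pair of polynomials, of degrees < a and < b. *)
Definition fst_poly w : {poly K} := rVpoly (lsubmx w).
Definition snd_poly w : {poly K} := rVpoly (rsubmx w).
Definition pair_rV p r : 'rV[K]_(a + b) := row_mx (poly_rV p) (poly_rV r).

Fact fst_poly_linear : linear fst_poly.
Proof. by move=> c w w'; rewrite /fst_poly !linearP. Qed.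
Fact snd_poly_linear : linear snd_poly.
Proof. by move=> c w w'; rewrite /snd_poly !linearP. Qed.
HB.instance Definition _ :=
  GRing.isLinear.Build K 'rV[K]_(a + b) {poly K} _ fst_poly fst_poly_linear.
HB.instance Definition _ :=
  GRing.isLinear.Build K 'rV[K]_(a + b) {poly K} _ snd_poly snd_poly_linear.

Lemma size_fst_poly w : (size (fst_poly w) <= a)%N.
Proof. exact: size_poly. Qed.
Lemma size_snd_poly w : (size (snd_poly w) <= b)%N.
Proof. exact: size_poly. Qed.

Lemma fst_pair_rV p r : (size p <= a)%N -> fst_poly (pair_rV p r) = p.
Proof. by move=> sp; rewrite /fst_poly row_mxKl poly_rV_K. Qed.
Lemma snd_pair_rV p r : (size r <= b)%N -> snd_poly (pair_rV p r) = r.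
Proof. by move=> sr; rewrite /snd_poly row_mxKr poly_rV_K. Qed.

Lemma eq_poly_pair w w' :
  fst_poly w = fst_poly w' -> snd_poly w = snd_poly w' -> w = w'.
Proof.
move=> /(can_inj (@rVpolyK _ _)) E1 /(can_inj (@rVpolyK _ _)) E2.
by rewrite -[w]hsubmxK E1 E2 hsubmxK.
Qed.

Lemma pair_rV_linear c p p' r r' :
  pair_rV (c *: p + p') (c *: r + r') = c *: pair_rV p r + pair_rV p' r'.
Proof. by rewrite /pair_rV !linearP scale_row_mx add_row_mx. Qed.

End PolynomialPairs.

Section ThreeIndices.

Definition o0 : 'I_3 := @Ordinal 3 0 isT.
Definition o1 : 'I_3 := @Ordinal 3 1 isT.
Definition o2 : 'I_3 := @Ordinal 3 2 isT.

Lemma sum3 (V : nmodType) (F : 'I_3 -> V) : \sum_i F i = F o0 + F o1 + F o2.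
Proof.
rewrite !big_ord_recl big_ord0 addr0 addrA.
by congr (F _ + F _ + F _); apply: val_inj.
Qed.

Lemma forall3 (P : 'I_3 -> Prop) : P o0 -> P o1 -> P o2 -> forall i, P i.
Proof.
move=> P0 P1 P2 [[|[|[|//]]] lt_i]; [move: P0|move: P1|move: P2];
by congr P; apply: val_inj.
Qed.

End ThreeIndices.

Section Example.
Context (K : closedFieldType) (q : nat).

Local Notation m := (q.+1 + q)%N.
Local Notation k := (q.+2 + q.+1)%N.
Implicit Types (u : 'rV[K]_m) (w : 'rV[K]_k) (v : 'rV[K]_3) (a : 'M[K]_(k, 3)).

(* A triple (A_0, A_1, A_2) of maps from pairs of degrees <= (q, q - 1) to pairs
   of degrees <= (q + 1, q): A_0 is the inclusion, A_1 the multiplication by X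
   and A_2 (p, r) = (p + X^2 r, 0). *)
Definition example_fun (B : 'M[K]_(3, m)) : 'rV[K]_k :=
  pair_rV q.+2 q.+1
    (fst_poly (row o0 B) + 'X * fst_poly (row o1 B) +
      (fst_poly (row o2 B) + 'X^2 * snd_poly (row o2 B)))
    (snd_poly (row o0 B) + 'X * snd_poly (row o1 B)).

Fact example_fun_linear : linear example_fun.
Proof.
move=> c B B'; rewrite /example_fun -pair_rV_linear; congr pair_rV;
rewrite !linearP /= -!mul_polyC; ring.
Qed.

HB.instance Definition _ :=
  GRing.isLinear.Build K 'M[K]_(3, m) 'rV[K]_k _ example_fun example_fun_linear.

Definition example : 'Hom('M[K]_(3, m), 'rV[K]_k) := linfun example_fun.

Local Notation H := (fiber_sub example).

Definition col_fst i a : {poly K} := fst_poly (col i a)^T.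
Definition col_snd i a : {poly K} := snd_poly (col i a)^T.

Lemma col_fst_linear i c a a' : col_fst i (c *: a + a') = c%:P * col_fst i a +
  col_fst i a'.
Proof. by rewrite /col_fst !linearP mul_polyC. Qed.
Lemma col_snd_linear i c a a' : col_snd i (c *: a + a') = c%:P * col_snd i a +
  col_snd i a'.
Proof. by rewrite /col_snd !linearP mul_polyC. Qed.

Lemma size_col_fst i a : (size (col_fst i a) <= q.+2)%N. Proof. exact:
  size_fst_poly. Qed.
Lemma size_col_snd i a : (size (col_snd i a) <= q.+1)%N. Proof. exact:
  size_snd_poly. Qed.

Lemma eq_cols a a' : (forall i, col_fst i a = col_fst i a') ->
  (forall i, col_snd i a = col_snd i a') ->
  a = a'.
Proof.
move=> EU ED; apply: (can_inj (@trmxK _ _ _)); apply/row_matrixP => i.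
by rewrite -!tr_col; apply: eq_poly_pair; [apply: EU | apply: ED].
Qed.

Lemma col_pure w v i : (col i (w^T *m v))^T = v ord0 i *: w.
Proof. by apply/rowP => l; rewrite !mxE big_ord1 !mxE mulrC. Qed.

Lemma col_fst_pure w v i : col_fst i (w^T *m v) = (v ord0 i)%:P * fst_poly w.
Proof. by rewrite /col_fst col_pure linearZ mul_polyC. Qed.
Lemma col_snd_pure w v i : col_snd i (w^T *m v) = (v ord0 i)%:P * snd_poly w.
Proof. by rewrite /col_snd col_pure linearZ mul_polyC. Qed.

Lemma col_tensor u i : (col i (tensor example u))^T = example (delta_mx i ord0 *m u).
Proof.
rewrite [u in RHS]row_sum_delta mulmx_sumr linear_sum /=.
apply/rowP => l; rewrite !mxE summxE; apply: eq_bigr => j _.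
by rewrite -scalemxAr mul_delta_mx linearZ !mxE.
Qed.

Lemma row_pure u (i j : 'I_3) : row j (delta_mx i ord0 *m u) = (j == i)%:R *: u.
Proof. by apply/rowP => l; rewrite !mxE big_ord1 !mxE eqxx andbT. Qed.

Lemma col_tensorE u i : (col i (tensor example u))^T =
  pair_rV q.+2 q.+1
    ((o0 == i)%:R *: fst_poly u + 'X * ((o1 == i)%:R *: fst_poly u) +
     (o2 == i)%:R *: (fst_poly u + 'X^2 * snd_poly u))
    ((o0 == i)%:R *: snd_poly u + 'X * ((o1 == i)%:R *: snd_poly u)).
Proof.
by rewrite col_tensor lfunE /= /example_fun !row_pure !linearZ /= scalerDr scalerAr.
Qed.

Lemma size_mulX_le (p : {poly K}) n : (size p <= n)%N -> (size ('X * p)%R <= n.+1)%N.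
Proof.
by move=> sp; rewrite mulrC; have [->|p0] := eqVneq p 0;
   rewrite ?mul0r ?size_poly0 // size_mulX.
Qed.

Lemma size_of_mulX (p : {poly K}) n : (size ('X * p)%R <= n.+1)%N -> (size p <= n)%N.
Proof.
have [->|p0] := eqVneq p 0; first by rewrite size_poly0.
by rewrite mulrC size_mulX.
Qed.

Lemma size_leD (p r : {poly K}) n :
  (size p <= n)%N -> (size r <= n)%N -> (size (p + r)%R <= n)%N.
Proof. by move=> sp sr; rewrite (leq_trans (size_polyD _ _)) // geq_max sp. Qed.

Lemma size_leB (p r : {poly K}) n :
  (size p <= n)%N -> (size r <= n)%N -> (size (p - r)%R <= n)%N.
Proof. by move=> sp sr; rewrite size_leD ?size_polyN. Qed.

Lemma size_polyCM c (p : {poly K}) n : (size p <= n)%N -> (size (c%:P * p)%R <= n)%N.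
Proof. by move=> sp; rewrite mul_polyC (leq_trans (size_scale_leq _ _)). Qed.

Lemma cols_tensor u :
  [/\ col_fst o0 (tensor example u) = fst_poly u,
      col_fst o1 (tensor example u) = 'X * fst_poly u &
      col_fst o2 (tensor example u) = fst_poly u + 'X^2 * snd_poly u] /\
  [/\ col_snd o0 (tensor example u) = snd_poly u,
      col_snd o1 (tensor example u) = 'X * snd_poly u &
      col_snd o2 (tensor example u) = 0].
Proof.
have su := size_fst_poly u; have sd := size_snd_poly u.
have sX2 : (size ('X^2 * snd_poly u)%R <= q.+2)%N.
  by rewrite expr2 -mulrA; do 2 apply: size_mulX_le.
rewrite /col_fst /col_snd !col_tensorE /= !scale0r !scale1r !mulr0 !addr0 !add0r.
split; split; rewrite ?fst_pair_rV ?snd_pair_rV ?size_poly0 //.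
- exact: leqW.
- exact: size_mulX_le.
- by apply: size_leD => //; apply: leqW.
- exact: leqW.
- exact: size_mulX_le.
Qed.

(* The components of X h_02 - h_12 - A_2 h_01, where h_ij = v_i a_j - v_j a_i. *)
Definition ann_fst v a : {poly K} :=
  let v0 := (v ord0 o0)%:P in let v1 := (v ord0 o1)%:P in let v2 := (v ord0 o2)%:P in
  'X * (v0 * col_fst o2 a - v2 * col_fst o0 a) - (v1 * col_fst o2 a - v2 * col_fst o1 a)
  - (v0 * col_fst o1 a - v1 * col_fst o0 a) - 'X^2 *
    (v0 * col_snd o1 a - v1 * col_snd o0 a).

Definition ann_snd v a : {poly K} :=
  let v0 := (v ord0 o0)%:P in let v1 := (v ord0 o1)%:P in let v2 := (v ord0 o2)%:P in
  'X * (v0 * col_snd o2 a - v2 * col_snd o0 a) -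
    (v1 * col_snd o2 a - v2 * col_snd o1 a).

Lemma ann_fst_linear v c a a' : ann_fst v (c *: a + a') = c%:P * ann_fst v a +
  ann_fst v a'.
Proof. rewrite /ann_fst !col_fst_linear !col_snd_linear; ring. Qed.

Lemma ann_snd_linear v c a a' : ann_snd v (c *: a + a') = c%:P * ann_snd v a +
  ann_snd v a'.
Proof. rewrite /ann_snd !col_snd_linear; ring. Qed.

Lemma ann_fst_linearl a c v v' : ann_fst (c *: v + v') a = c%:P * ann_fst v a +
  ann_fst v' a.
Proof. rewrite /ann_fst !mxE !(polyCM, polyCD); ring. Qed.

Lemma ann_snd_linearl a c v v' : ann_snd (c *: v + v') a = c%:P * ann_snd v a +
  ann_snd v' a.
Proof. rewrite /ann_snd !mxE !(polyCM, polyCD); ring. Qed.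

Lemma col_fstD i a a' : col_fst i (a + a') = col_fst i a + col_fst i a'.
Proof. by rewrite -{1}[a]scale1r col_fst_linear mul1r. Qed.
Lemma col_sndD i a a' : col_snd i (a + a') = col_snd i a + col_snd i a'.
Proof. by rewrite -{1}[a]scale1r col_snd_linear mul1r. Qed.

(** On v (x) w all h_ij vanish. On phi(u) the terms in v_2 cancel, and (v_0 X - v_1) A_2 u - A_2
    (v_0 X - v_1) u remains. *)
Lemma ann_fiber v u w : ann_fst v (tensor example u + w^T *m v) = 0 /\
  ann_snd v (tensor example u + w^T *m v) = 0.
Proof.
have [[U0 U1 U2] [D0 D1 D2]] := cols_tensor u.
rewrite /ann_fst /ann_snd !col_fstD !col_sndD !col_fst_pure !col_snd_pure U0 U1 U2
  D0 D1 D2.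
split; ring.
Qed.

Lemma ann_fiber_sub v a x : v != 0 -> v \in line x -> a \in H x ->
  ann_fst v a = 0 /\ ann_snd v a = 0.
Proof. by move=> v0 vx /(fiber_subP _ _ vx v0)[u [w ->]]; apply: ann_fiber. Qed.

(** If phi(u) = v (x) w, the components of indices 0 and 1 give u = v_0 w and X u = v_1 w, so (v_1 -
    v_0 X) w = 0: either v_0 = 0 or w = 0, and u = 0 in both cases. *)
Lemma example_injective : fiberwise_injective example.
Proof.
move=> u w v v0 E; have [[U0 U1 U2] [D0 D1 D2]] := cols_tensor u.
rewrite E !col_fst_pure in U0 U1 U2; rewrite E !col_snd_pure in D0 D1 D2.
suff key (p r : {poly K}) : (v ord0 o0)%:P * r = p -> (v ord0 o1)%:P * r = 'X * p
  -> p = 0.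
  by apply: eq_poly_pair; rewrite linear0; [apply: key U0 U1 | apply: key D0 D1].
have [->|v00] := eqVneq (v ord0 o0) 0; first by rewrite mul0r => <-.
move=> <- E1; have : ((v ord0 o1)%:P - 'X * (v ord0 o0)%:P) * r = 0.
  by rewrite mulrBl E1 mulrA subrr.
move=> /eqP; rewrite mulf_eq0 => /orP[|/eqP->]; last by rewrite mulr0.
rewrite subr_eq0 => /eqP/(congr1 (fun p : {poly K} => p`_1)).
by rewrite coefC mulrC coefMX coefC /= => /esym/eqP; rewrite (negPf v00).
Qed.

Lemma size_div_XsubC (p r : {poly K}) c n :
  p = ('X - c%:P) * r -> (size p <= n.+1)%N -> (size r <= n)%N.
Proof.
have [->|r0] := eqVneq r 0; first by rewrite size_poly0.
by move=> ->; rewrite size_monicM ?monicXsubC // size_XsubC.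
Qed.

Lemma horner_eq0_factor (p : {poly K}) c : p.[c] = 0 -> exists r, p = ('X - c%:P) * r.
Proof. by move=> /eqP/factor_theorem[r ->]; exists r; rewrite mulrC. Qed.

(* On the chart v = (1, c, z), u is h_01 / (X - c), where h_01 is the minor of
   (v, a); its divisibility by X - c is where z <> 0 and z <> 1 are needed. *)
Lemma ann_generic v a x : v \in line x -> v ord0 o0 = 1 ->
  v ord0 o2 != 0 -> v ord0 o2 != 1 -> ann_fst v a = 0 -> ann_snd v a = 0 -> a \in H x.
Proof.
move=> vx v01; set z := v ord0 o2; set c := v ord0 o1 => z0 z1 EU ED.
have v0 : v != 0.
  by apply/eqP => /rowP/(_ o0); rewrite v01 mxE => /eqP; rewrite oner_eq0.
have diff (p r : {poly K}) : exists h, p = h + r by exists (p - r); rewrite subrK.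
have [hU hUE] := diff (col_fst o1 a) (c%:P * col_fst o0 a).
have [hD hDE] := diff (col_snd o1 a) (c%:P * col_snd o0 a).
have [gU gUE'] := diff (col_fst o2 a) (z%:P * col_fst o0 a).
have [gD gDE'] := diff (col_snd o2 a) (z%:P * col_snd o0 a).
have ED' : ('X - c%:P) * gD + z%:P * hD = 0.
  rewrite -ED /ann_snd v01 -/z -/c gDE' hDE; ring.
have EU' : ('X - c%:P) * gU + (z%:P - 1) * hU - 'X^2 * hD = 0.
  rewrite -EU /ann_fst v01 -/z -/c gUE' hUE hDE; ring.
have hDc : hD.[c] = 0.
  have := congr1 (fun p : {poly K} => p.[c]) ED'; rewrite !hornerE subrr mul0r add0r.
  by move=> /eqP; rewrite mulf_eq0 (negPf z0) => /eqP.
have hUc : hU.[c] = 0.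
  have := congr1 (fun p : {poly K} => p.[c]) EU'.
  rewrite !(hornerM, hornerD, hornerN, hornerX, hornerC) hDc !mulr0 subrr mul0r add0r.
  by move=> /eqP; rewrite oppr0 addr0 mulf_eq0 subr_eq0 (negPf z1) => /eqP.
have [p pE] := horner_eq0_factor hUc; have [r rE] := horner_eq0_factor hDc.
have Xn : 'X - c%:P != 0 :> {poly K} by rewrite polyXsubC_eq0.
(* With u = (p, r) = h_01 / (X - c), cancelling X - c gives h_02 = A_2 u - z u. *)
have gDE : gD = - (z%:P * r).
  apply: (mulfI Xn); apply/eqP; rewrite -subr_eq0 -ED' rE; apply/eqP; ring.
have gUE : gU = 'X^2 * r - (z%:P - 1) * p.
  apply: (mulfI Xn); apply/eqP; rewrite -subr_eq0 -EU' pE rE; apply/eqP; ring.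
(* Division by X - c lowers degrees by one, exactly the gap between N and M. *)
have sp : (size p <= q.+1)%N.
  have hE : hU = col_fst o1 a - c%:P * col_fst o0 a by rewrite hUE addrK.
  apply: (size_div_XsubC pE); rewrite hE; apply: size_leB; first exact: size_col_fst.
  by apply: size_polyCM; apply: size_col_fst.
have sr : (size r <= q)%N.
  have hE : hD = col_snd o1 a - c%:P * col_snd o0 a by rewrite hDE addrK.
  apply: (size_div_XsubC rE); rewrite hE; apply: size_leB; first exact: size_col_snd.
  by apply: size_polyCM; apply: size_col_snd.
apply/(fiber_subP _ _ vx v0); exists (pair_rV q.+1 q p r).
exists (pair_rV q.+2 q.+1 (col_fst o0 a - p) (col_snd o0 a - r)).
have [[U0 U1 U2] [D0 D1 D2]] := cols_tensor (pair_rV q.+1 q p r).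
have sw : (size (col_fst o0 a - p)%R <= q.+2)%N by rewrite size_leB ?size_col_fst
  // leqW.
have sw' : (size (col_snd o0 a - r)%R <= q.+1)%N by rewrite size_leB ?size_col_snd
  // leqW.
apply: eq_cols; apply: forall3;
  rewrite (col_fstD, col_sndD) (col_fst_pure, col_snd_pure)
  ?U0 ?U1 ?U2 ?D0 ?D1 ?D2 ?fst_pair_rV ?snd_pair_rV // ?v01 -/c -/z;
  rewrite ?hUE ?hDE ?gUE' ?gDE' ?gUE ?gDE ?pE ?rE; ring.
Qed.

(** * Global sections of the cokernel *)

Definition row3 (x y z : K) : 'rV[K]_3 :=
  x *: delta_mx 0 o0 + y *: delta_mx 0 o1 + z *: delta_mx 0 o2.

Lemma row3E x y z : [/\ row3 x y z ord0 o0 = x, row3 x y z ord0 o1 = y &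
  row3 x y z ord0 o2 = z].
Proof.
by split; rewrite /row3 !mxE /= ?(mulr0n, mulr1n) ?(mulr0, mulr1, addr0, add0r).
Qed.

Lemma row3_neq0 x y z : (x != 0) || (z != 0) -> row3 x y z != 0.
Proof.
have [x0 y0 z0] := row3E x y z; apply: contraTneq => E.
have -> : x = 0 by rewrite -x0 E mxE.
have -> : z = 0 by rewrite -z0 E mxE.
by rewrite eqxx.
Qed.

Lemma ann_fst_delta a : [/\ ann_fst (delta_mx 0 o0) a = 'X * col_fst o2 a - col_fst
  o1 a - 'X^2 * col_snd o1 a,
  ann_fst (delta_mx 0 o1) a = col_fst o0 a - col_fst o2 a + 'X^2 * col_snd o0 a &
  ann_fst (delta_mx 0 o2) a = col_fst o1 a - 'X * col_fst o0 a].
Proof. by rewrite /ann_fst !mxE /= !(mulr0n, mulr1n);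
  split; rewrite ?polyC0 ?polyC1; ring. Qed.

Lemma ann_snd_delta a : [/\ ann_snd (delta_mx 0 o0) a = 'X * col_snd o2 a,
  ann_snd (delta_mx 0 o1) a = - col_snd o2 a &
  ann_snd (delta_mx 0 o2) a = col_snd o1 a - 'X * col_snd o0 a].
Proof. by rewrite /ann_snd !mxE /= !(mulr0n, mulr1n);
  split; rewrite ?polyC0 ?polyC1; ring. Qed.

(** The three conditions describe the chart v = (1, c, z) with z different from 0 and 1, where
    [ann_generic] applies; [fiber_sub_closed] then reaches all points. *)
Lemma quot_const_near s a :
  (forall x, gen x ord0 o0 != 0 -> gen x ord0 o2 != 0 -> gen x ord0 o0 != gen x
    ord0 o2 ->
    quot_fun s (mkpt (I : pts (allP2 K) x)) - a \in H x) ->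
  s = quot_const H (allP2 K) a.
Proof.
move=> sE; pose h : {mpoly K[3]} := 'X_o0 * 'X_o2 * ('X_o0 - 'X_o2).
have hX l : ('X_l : {mpoly K[3]}) \is 1.-homog by rewrite dhomogX; apply/eqP/mdeg1.
have hh : h \is 3.-homog.
  exact: (dhomogM (dhomogM (hX o0) (hX o2)) (rpredB (hX o0) (hX o2))).
have pX l v : peval 'X_l v = v ord0 l by rewrite /peval mevalXU.
have hE v : peval h v = v ord0 o0 * v ord0 o2 * (v ord0 o0 - v ord0 o2).
  by rewrite !pevalM pevalB !pX.
have oD := basic_open hh; set D := [set y | _] in oD.
have D0 : D !=set0.
  have X1 : 'X * ('X - 1) != 0 :> {poly K}.
    by rewrite mulf_neq0 ?polyX_eq0 // -polyC1 polyXsubC_eq0.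
  have [t] := poly_neq0_horner X1; rewrite !hornerE mulf_eq0 => /norP[t0 t1].
  have v0 : row3 1 0 t != 0 by rewrite row3_neq0 // oner_eq0.
  exists (point (row3 1 0 t)) => v vx vn.
  apply: (peval_homog_line hh vx (mem_point v0) vn); have [E0 _ E2] := row3E 1 0 t.
  by rewrite hE E0 E2 mul1r mulf_neq0 // subr_eq0 eq_sym -subr_eq0.
apply: quot_eq => x; have [g [hg gE]] := quot_sec_regular s (I : pts (allP2 K) (val x)).
have xE : mkpt (I : pts (allP2 K) (val x)) = x by apply: set_type_eq.
rewrite -[in LHS]xE (nbhs_singleton gE); apply/(eq_quot_class H (val x)).
have hga : mx_near (val x) (fun y => g y - a).
  by apply: mx_nearB hg _; apply: mx_near_const.
apply: (fiber_sub_closed (example_injective) oD D0 hga).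
move: gE; apply: filterS => y gy Dy.
have := Dy _ (gen_mem y) (gen_neq0 y).
rewrite hE !mulf_eq0 subr_eq0 => /norP[/norP[y0 y2] y02].
have := sE y y0 y2 y02; rewrite gy => /memvD/(_ (quot_classK H y (g y))).
by rewrite addrC addrA subrK.
Qed.

(** The images of s under [ann_fst] and [ann_snd] are linear in v, with coefficients [bU] and [bD].
    Two polynomial identities between these coefficients make them the images of a constant a, which
    has the class of s at generic points. *)
Lemma example_global (s : quot_sec H (allP2 K)) :
  exists a, s = quot_const H (allP2 K) a.
Proof.
pose S v := quot_fun s (mkpt (I : pts (allP2 K) (point v))).
have [bU bUE] : exists b, forall i, b i = ann_fst (delta_mx 0 i) (S (delta_mx 0 i)).
  by exists (fun i => ann_fst (delta_mx 0 i) (S (delta_mx 0 i))).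
have [bD bDE] : exists b, forall i, b i = ann_snd (delta_mx 0 i) (S (delta_mx 0 i)).
  by exists (fun i => ann_snd (delta_mx 0 i) (S (delta_mx 0 i))).
have linU v : v != 0 -> ann_fst v (S v) = \sum_i (v ord0 i)%:P * bU i.
  move=> v0; apply/polyP => d; rewrite coef_sum.
  have -> := @global_section_linear K k H (fun v a => (ann_fst v a)`_d) s _ _ _ v v0.
  - by apply: eq_bigr => i _; rewrite coefCM ?bUE ?bDE.
  - by move=> c u u' a; rewrite ann_fst_linearl coefD coefCM.
  - by move=> c u a a'; rewrite ann_fst_linear coefD coefCM.
  - by move=> u a u0 /(ann_fiber_sub u0 (mem_point u0))[->]; rewrite coef0.
have linD v : v != 0 -> ann_snd v (S v) = \sum_i (v ord0 i)%:P * bD i.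
  move=> v0; apply/polyP => d; rewrite coef_sum.
  have -> := @global_section_linear K k H (fun v a => (ann_snd v a)`_d) s _ _ _ v v0.
  - by apply: eq_bigr => i _; rewrite coefCM ?bUE ?bDE.
  - by move=> c u u' a; rewrite ann_snd_linearl coefD coefCM.
  - by move=> c u a a'; rewrite ann_snd_linear coefD coefCM.
  - by move=> u a u0 /(ann_fiber_sub u0 (mem_point u0))[_ ->]; rewrite coef0.
have [bU0 _ _] := ann_fst_delta (S (delta_mx 0 o0));
  have [_ bU1 _] := ann_fst_delta (S (delta_mx 0 o1)).
have [_ _ bU2] := ann_fst_delta (S (delta_mx 0 o2)).
have [bD0 _ _] := ann_snd_delta (S (delta_mx 0 o0));
  have [_ bD1 _] := ann_snd_delta (S (delta_mx 0 o1)).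
have [_ _ bD2] := ann_snd_delta (S (delta_mx 0 o2)).
rewrite -(bUE o0) in bU0; rewrite -(bUE o1) in bU1; rewrite -(bUE o2) in bU2.
rewrite -(bDE o0) in bD0; rewrite -(bDE o1) in bD1; rewrite -(bDE o2) in bD2.
(* At v = (1, c, 0), [ann_snd] is a multiple of X - c; evaluating at X = c for every c gives the
   identity. *)
have condD : bD o0 + 'X * bD o1 = 0.
  apply: poly_eq0_horner => c; have [v0 v1 v2] := row3E 1 c 0.
  have /linD : row3 1 c 0 != 0 by rewrite row3_neq0 // oner_eq0.
  rewrite sum3 /ann_snd v0 v1 v2 => /(congr1 (fun p : {poly K} => p.[c])).
  rewrite !(hornerM, hornerD, hornerN, hornerX, hornerC) => E.
  rewrite -[LHS]addr0 -[X in _ + X](mul0r (bD o2).[c]) -[X in X + _ + _]mul1r -E; ring.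
(* The same at z = 1: the row (1, X^2) is killed by 1 - A_2, so [ann_fst] + X^2 [ann_snd] vanishes
   at X = c. [condD] removes the terms in [bD o0] and [bD o1]. *)
have condU : bU o0 + 'X * bU o1 + bU o2 + 'X^2 * bD o2 = 0.
  rewrite -[LHS]addr0 -[X in _ + X](mulr0 'X^2) -[X in _ + _ * X]condD.
  apply: poly_eq0_horner => c; have [v0 v1 v2] := row3E 1 c 1.
  have v_neq0 : row3 1 c 1 != 0 by rewrite row3_neq0 // oner_eq0.
  have := linD _ v_neq0; rewrite sum3 /ann_snd v0 v1 v2.
  have := linU _ v_neq0; rewrite sum3 /ann_fst v0 v1 v2.
  move=> /(congr1 (fun p : {poly K} => p.[c])) EU.
  move=> /(congr1 (fun p : {poly K} => p.[c])) ED.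
  rewrite !(hornerM, hornerD, hornerN, hornerX, hornerC, hornerXn) in EU ED *.
  set x1 := (bU o0).[c] in EU *; set x2 := (bU o1).[c] in EU *.
  set x3 := (bU o2).[c] in EU *; set y1 := (bD o0).[c] in ED *.
  set y2 := (bD o1).[c] in ED *; set y3 := (bD o2).[c] in ED *.
  have -> : x1 + c * x2 + x3 + c ^+ 2 * y3 + c ^+ 2 * (y1 + c * y2) =
    (1 * x1 + c * x2 + 1 * x3) + c ^+ 2 * (1 * y1 + c * y2 + 1 * y3) by ring.
  rewrite -EU -ED; ring.
set A2 := S (delta_mx 0 o2) in bU2 bD2.
have [GU GUE] : exists G, G = col_fst o0 A2 + 'X^2 * col_snd o0 A2 - bU o1 by eexists.
have bU1E : bU o1 = col_fst o0 A2 + 'X^2 * col_snd o0 A2 - GU by rewrite GUE opprB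
  addrC subrK.
have bU0E : bU o0 = 'X * GU - col_fst o1 A2 - 'X^2 * col_snd o1 A2.
  apply/eqP; rewrite -subr_eq0 -condU bU1E bU2 bD2; apply/eqP; ring.
have bD0E : bD o0 = - ('X * bD o1) by apply/eqP; rewrite -addr_eq0 condD.
have sD : (size (- bD o1)%R <= q.+1)%N by rewrite bD1 opprK size_col_snd.
have sX2 a i : (size ('X^2 * col_snd i a)%R <= q.+3)%N.
  by rewrite expr2 -mulrA; do 2 apply: size_mulX_le; apply: size_col_snd.
(* The definition of [GU] bounds its size only by q + 3; the equation for [bU o0] gives the same
   bound for X [GU], which gains one. *)
have sU : (size GU <= q.+2)%N.
  apply: size_of_mulX.
  have -> : 'X * GU = bU o0 + col_fst o1 A2 + 'X^2 * col_snd o1 A2 by rewrite bU0E;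
    ring.
  rewrite bU0; apply: size_leD => //; apply: size_leD; last exact/leqW/size_col_fst.
  apply: size_leB => //; apply: size_leB; last exact/leqW/size_col_fst.
  exact/size_mulX_le/size_col_fst.
(* Columns 0 and 1 come from the value at e_2, where the annihilator involves only these; [bU o1]
   and [bD o1] prescribe column 2. *)
pose W i : 'rV[K]_k := if i == o2 then pair_rV q.+2 q.+1 GU (- bD o1) else (col i A2)^T.
pose a : 'M[K]_(k, 3) := \matrix_(l, i) W i ord0 l.
have colW i : (col i a)^T = W i by apply/rowP => l; rewrite !mxE.
have [a0 a1 a2] : [/\ col_fst o0 a = col_fst o0 A2,
  col_fst o1 a = col_fst o1 A2 & col_fst o2 a = GU].
  by rewrite /col_fst !colW /W /= fst_pair_rV.
have [d0 d1 d2] : [/\ col_snd o0 a = col_snd o0 A2,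
  col_snd o1 a = col_snd o1 A2 & col_snd o2 a = - bD o1].
  by rewrite /col_snd !colW /W /= snd_pair_rV.
have BUa v : v != 0 -> ann_fst v (S v) = ann_fst v a.
  move=> v0; rewrite linU // sum3 /ann_fst a0 a1 a2 d0 d1 bU0E bU1E bU2; ring.
have BDa v : v != 0 -> ann_snd v (S v) = ann_snd v a.
  move=> v0; rewrite linD // sum3 /ann_snd d0 d1 d2 bD0E bD2; ring.
exists a; apply: quot_const_near => x x0 x2 x02.
pose v := (gen x ord0 o0)^-1 *: gen x.
have v0 : v != 0 by rewrite scaler_eq0 invr_eq0 (negPf x0) gen_neq0.
have vx : v \in line x by rewrite memvZ ?gen_mem.
have -> : quot_fun s (mkpt (I : pts (allP2 K) x)) = S v.
  by congr (quot_fun s _); apply: set_type_eq; rewrite /= (point_mem v0 vx).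
have BB (B : 'rV[K]_3 -> 'M[K]_(k, 3) -> {poly K}) :
    (forall v c b b', B v (c *: b + b') = c%:P * B v b + B v b') ->
    B v (S v) = B v a -> B v (S v - a) = 0.
  move=> Blin E; rewrite -scaleN1r addrC Blin E polyCN mulN1r.
  exact: addNr.
apply: (ann_generic vx); rewrite ?mxE.
- by rewrite mulVf.
- by rewrite mulf_neq0 ?invr_eq0.
- by apply: contra x02 => /eqP E; rewrite -[gen x ord0 o2](mulVKf x0) E mulr1.
- by apply: BB; [exact: ann_fst_linear | exact: BUa].
- by apply: BB; [exact: ann_snd_linear | exact: BDa].
Qed.

Lemma delta_mx_neq0 (i : 'I_3) : delta_mx 0 i != 0 :> 'rV[K]_3.
Proof. by apply/eqP => /rowP/(_ i); rewrite !mxE !eqxx => /eqP; rewrite oner_eq0. Qed.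

Lemma sum_cols a : a = \sum_i col i a *m delta_mx 0 i.
Proof.
apply/matrixP => l j; rewrite summxE (bigD1 j) //= big1 ?addr0 => [|i ij].
  by rewrite !mxE big_ord1 !mxE !eqxx mulr1.
by rewrite !mxE big_ord1 !mxE [j == i]eq_sym (negPf ij) mulr0.
Qed.

Lemma tensor_fiber u x : tensor example u \in H x.
Proof.
apply/(fiber_subP _ _ (gen_mem x) (gen_neq0 x)); exists u, 0.
by rewrite trmx0 mul0mx addr0.
Qed.

(** * Linear maps preserving every fibre of H *)

Section Stabilizer.
Variable E : {linear 'M[K]_(k, 3) -> 'M[K]_(k, 3)}.
Hypothesis EH : forall x a, a \in H x -> E a \in H x.

Local Notation e i := (delta_mx 0 i : 'rV[K]_3).
Local Notation F j w := (E (w^T *m e j)).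

Lemma ann_image v w : v != 0 -> ann_fst v (E (w^T *m v)) = 0 /\ ann_snd v
  (E (w^T *m v)) = 0.
Proof.
move=> v0; apply: (ann_fiber_sub v0 (mem_point v0)); apply: EH.
apply/(fiber_subP _ _ (mem_point v0) v0); exists 0, w.
by rewrite linear0 add0r.
Qed.

(** The annihilator at v of E (w (x) v) is quadratic in v and vanishes; these are its mixed terms,
    isolated at e_i + e_j. *)
Lemma ann_polar i j w : i != j ->
  ann_fst (e i) (F j w) + ann_fst (e j) (F i w) = 0 /\ ann_snd (e i) (F j w) +
    ann_snd (e j) (F i w) = 0.
Proof.
move=> ij; have [Ui Di] := ann_image w (delta_mx_neq0 i).
have [Uj Dj] := ann_image w (delta_mx_neq0 j).
have ij0 : e i + e j != 0.
  apply/eqP => /rowP/(_ i); rewrite !mxE !eqxx (negPf ij) addr0 => /eqP.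
  by rewrite oner_eq0.
have [] := ann_image w ij0; rewrite mulmxDr linearD /=.
have UD v a a' : ann_fst v (a + a') = ann_fst v a + ann_fst v a'.
  by rewrite -{1}[a]scale1r ann_fst_linear mul1r.
have DD v a a' : ann_snd v (a + a') = ann_snd v a + ann_snd v a'.
  by rewrite -{1}[a]scale1r ann_snd_linear mul1r.
have UDl v v' a : ann_fst (v + v') a = ann_fst v a + ann_fst v' a.
  by rewrite -{1}[v]scale1r ann_fst_linearl mul1r.
have DDl v v' a : ann_snd (v + v') a = ann_snd v a + ann_snd v' a.
  by rewrite -{1}[v]scale1r ann_snd_linearl mul1r.
by rewrite UD !UDl Ui Uj DD !DDl Di Dj !add0r !addr0 [X in X = 0 -> _]addrC
   [X in _ -> X = 0 -> _]addrC.
Qed.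

(** Meant for E (w (x) e_2) = beta(w) (x) e_2 + phi(u): column 0 is u, as A_0 is the inclusion, and
    A_2 u is subtracted from column 2. The second component of A_2 u is 0, so [beta_snd] has no
    correction. *)
Definition beta_fst w : {poly K} :=
  col_fst o2 (F o2 w) - col_fst o0 (F o2 w) - 'X^2 * col_snd o0 (F o2 w).
Definition beta_snd w : {poly K} := col_snd o2 (F o2 w).

Lemma image_linear j c w w' : F j (c *: w + w') = c *: F j w + F j w'.
Proof. by rewrite linearP /= mulmxDl -scalemxAl linearP. Qed.

Lemma beta_fst_linear c w w' : beta_fst (c *: w + w') = c%:P * beta_fst w + beta_fst w'.
Proof. rewrite /beta_fst image_linear !col_fst_linear !col_snd_linear; ring. Qed.
Lemma beta_snd_linear c w w' : beta_snd (c *: w + w') = c%:P * beta_snd w + beta_snd w'.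
Proof. by rewrite /beta_snd image_linear !col_snd_linear. Qed.

Lemma polyX_cancel (p r : {poly K}) : 'X * p = 'X * r -> p = r.
Proof. by apply: mulfI; rewrite polyX_eq0. Qed.

(** The polarized relations with index 2 carry beta from j = 2 to the other j. The vector u is
    column 0 of F j w, less beta(w) when j = 0; it lies in M because column 1 contains X u and has
    bounded degree. *)
Lemma image_pure w : [/\ (size (beta_fst w) <= q.+2)%N, (size (beta_snd w) <= q.+1)%N &
  forall j, exists u, F j w = (pair_rV q.+2 q.+1 (beta_fst w) (beta_snd w))^T *m e j +
    tensor example u].
Proof.
have [B22U B22D] := ann_image w (delta_mx_neq0 o2).
have [B00U B00D] := ann_image w (delta_mx_neq0 o0).
have [B11U B11D] := ann_image w (delta_mx_neq0 o1).
have [B12U B12D] := @ann_polar o1 o2 w isT.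
have [B02U B02D] := @ann_polar o0 o2 w isT.
have U0 a := let: And3 h _ _ := ann_fst_delta a in h.
have U1 a := let: And3 _ h _ := ann_fst_delta a in h.
have U2 a := let: And3 _ _ h := ann_fst_delta a in h.
have D0 a := let: And3 h _ _ := ann_snd_delta a in h.
have D1 a := let: And3 _ h _ := ann_snd_delta a in h.
have D2 a := let: And3 _ _ h := ann_snd_delta a in h.
rewrite !(U0, U1, U2) in B22U B00U B11U B12U B02U.
rewrite !(D0, D1, D2) in B22D B00D B11D B12D B02D.
have bUE : beta_fst w = col_fst o2 (F o2 w) - col_fst o0 (F o2 w) - 'X^2 * col_snd
  o0 (F o2 w) by [].
have bDE : beta_snd w = col_snd o2 (F o2 w) by [].
have sUF i j : (size (col_fst i (F j w)) <= q.+2)%N by apply: size_col_fst.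
have sDF i j : (size (col_snd i (F j w)) <= q.+1)%N by apply: size_col_snd.
move: bUE bDE; move: (beta_fst w) (beta_snd w) => bU bD bUE bDE.
have solve (p r s : {poly K}) : s = 0 -> p - r = s -> p = r.
  by move=> -> /eqP; rewrite subr_eq0 => /eqP.
have E12U : col_fst o1 (F o2 w) = 'X * col_fst o0 (F o2 w) by apply: (solve _ _ _ B22U).
have E12D : col_snd o1 (F o2 w) = 'X * col_snd o0 (F o2 w) by apply: (solve _ _ _ B22D).
have E11U : col_fst o1 (F o1 w) = bU + 'X * col_fst o0 (F o1 w).
  apply: (solve _ _ _ B12U); rewrite bUE; ring.
have E11D : col_snd o1 (F o1 w) = bD + 'X * col_snd o0 (F o1 w).
  apply: (solve _ _ _ B12D); rewrite bDE; ring.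
have E10U : col_fst o1 (F o0 w) = 'X * (col_fst o0 (F o0 w) - bU).
  apply: (solve _ _ _ B02U); rewrite bUE E12U E12D; ring.
have E10D : col_snd o1 (F o0 w) = 'X * (col_snd o0 (F o0 w) - bD).
  apply: (solve _ _ _ B02D); rewrite bDE; ring.
have E21U : col_fst o2 (F o1 w) = col_fst o0 (F o1 w) + 'X^2 * col_snd o0 (F o1 w).
  apply/esym; apply: (solve _ _ _ B11U); ring.
have E21D : col_snd o2 (F o1 w) = 0 by move/eqP: B11D; rewrite oppr_eq0 => /eqP.
have E20U : col_fst o2 (F o0 w) =
    (col_fst o0 (F o0 w) - bU) + 'X^2 * (col_snd o0 (F o0 w) - bD).
  apply: polyX_cancel; apply: (solve _ _ _ B00U); rewrite E10U E10D; ring.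
have E20D : col_snd o2 (F o0 w) = 0 by apply: polyX_cancel; rewrite mulr0.
have s2U : (size (col_fst o0 (F o2 w)) <= q.+1)%N by apply: size_of_mulX; rewrite -E12U.
have s2D : (size (col_snd o0 (F o2 w)) <= q)%N by apply: size_of_mulX; rewrite -E12D.
have sbU : (size bU <= q.+2)%N.
  rewrite bUE; apply: size_leB; first exact: size_leB.
  by rewrite expr2 -mulrA; do 2 apply: size_mulX_le.
have sbD : (size bD <= q.+1)%N by rewrite bDE.
have s1U : (size (col_fst o0 (F o1 w)) <= q.+1)%N.
  apply: size_of_mulX; have -> : 'X * col_fst o0 (F o1 w) = col_fst o1 (F o1 w) - bU.
    by rewrite E11U addrC addKr.
  exact: size_leB.
have s1D : (size (col_snd o0 (F o1 w)) <= q)%N.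
  apply: size_of_mulX; have -> : 'X * col_snd o0 (F o1 w) = col_snd o1 (F o1 w) - bD.
    by rewrite E11D addrC addKr.
  exact: size_leB.
have s0U : (size (col_fst o0 (F o0 w) - bU)%R <= q.+1)%N.
  by apply: size_of_mulX; rewrite -E10U.
have s0D : (size (col_snd o0 (F o0 w) - bD)%R <= q)%N.
  by apply: size_of_mulX; rewrite -E10D.
split=> //; apply: forall3.
- exists (pair_rV q.+1 q (col_fst o0 (F o0 w) - bU) (col_snd o0 (F o0 w) - bD)).
  have [[t0 t1 t2] [r0 r1 r2]] := cols_tensor
    (pair_rV q.+1 q (col_fst o0 (F o0 w) - bU) (col_snd o0 (F o0 w) - bD)).
  apply: eq_cols; apply: forall3;
    rewrite (col_fstD, col_sndD) (col_fst_pure, col_snd_pure)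
    ?t0 ?t1 ?t2 ?r0 ?r1 ?r2 ?fst_pair_rV ?snd_pair_rV // !mxE /= ?polyC0 ?polyC1.
  + ring.
  + rewrite E10U; ring.
  + rewrite E20U; ring.
  + ring.
  + rewrite E10D; ring.
  + rewrite E20D; ring.
- exists (pair_rV q.+1 q (col_fst o0 (F o1 w)) (col_snd o0 (F o1 w))).
  have [[t0 t1 t2] [r0 r1 r2]] := cols_tensor
    (pair_rV q.+1 q (col_fst o0 (F o1 w)) (col_snd o0 (F o1 w))).
  apply: eq_cols; apply: forall3;
    rewrite (col_fstD, col_sndD) (col_fst_pure, col_snd_pure)
    ?t0 ?t1 ?t2 ?r0 ?r1 ?r2 ?fst_pair_rV ?snd_pair_rV // !mxE /= ?polyC0 ?polyC1.
  + ring.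
  + rewrite E11U; ring.
  + rewrite E21U; ring.
  + ring.
  + rewrite E11D; ring.
  + rewrite E21D; ring.
- exists (pair_rV q.+1 q (col_fst o0 (F o2 w)) (col_snd o0 (F o2 w))).
  have [[t0 t1 t2] [r0 r1 r2]] := cols_tensor
    (pair_rV q.+1 q (col_fst o0 (F o2 w)) (col_snd o0 (F o2 w))).
  apply: eq_cols; apply: forall3;
    rewrite (col_fstD, col_sndD) (col_fst_pure, col_snd_pure)
    ?t0 ?t1 ?t2 ?r0 ?r1 ?r2 ?fst_pair_rV ?snd_pair_rV // !mxE /= ?polyC0 ?polyC1.
  + ring.
  + rewrite E12U; ring.
  + rewrite bUE; ring.
  + ring.
  + rewrite E12D; ring.
  + rewrite bDE; ring.
Qed.

Lemma image_decomp a : exists u, E a =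
  (\matrix_(l, j) pair_rV q.+2 q.+1 (beta_fst (col j a)^T) (beta_snd (col j a)^T)
    ord0 l) +
  tensor example u.
Proof.
have /choice[u uE] j := (let: And3 _ _ h := image_pure (col j a)^T in h) j.
exists (\sum_j u j); rewrite [X in X + _]sum_cols [tensor _ _]linear_sum -big_split /=.
rewrite {1}[a]sum_cols linear_sum; apply: eq_bigr => j _.
rewrite -{1}[col j a]trmxK uE; congr (_ *m _ + _).
by apply/matrixP => l r; rewrite !mxE (ord1 r).
Qed.

(* beta is an endomorphism of the Kronecker module phi. *)
Lemma beta_module u : let c j := (col j (tensor example u))^T in
  [/\ beta_fst (c o1) = 'X * beta_fst (c o0), beta_snd (c o1) = 'X * beta_snd (c o0) &
      beta_fst (c o2) = beta_fst (c o0) + 'X^2 * beta_snd (c o0)].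
Proof.
move=> c; have [u' uE] := image_decomp (tensor example u).
set b := (\matrix_(_, _) _) in uE.
(* b differs from E (phi(u)) by an element of phi(M), so it lies in every fibre of H. *)
have bB v : v != 0 -> ann_fst v b = 0 /\ ann_snd v b = 0.
  move=> v0; apply: (ann_fiber_sub v0 (mem_point v0)).
  rewrite -[b](addrK (tensor example u')) -uE memvB ?tensor_fiber //.
  exact/EH/tensor_fiber.
have cb j : (col j b)^T = pair_rV q.+2 q.+1 (beta_fst (c j)) (beta_snd (c j)).
  by apply/rowP => l; rewrite !mxE.
have bU j : col_fst j b = beta_fst (c j).
  by rewrite /col_fst cb fst_pair_rV //; case: (image_pure (c j)).
have bD j : col_snd j b = beta_snd (c j).
  by rewrite /col_snd cb snd_pair_rV //; case: (image_pure (c j)).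
have [B1U _] := bB _ (delta_mx_neq0 o1); have [B2U B2D] := bB _ (delta_mx_neq0 o2).
have [_ E1 _] := ann_fst_delta b;
  have [_ _ E2] := ann_fst_delta b; have [_ _ E3] := ann_snd_delta b.
rewrite E1 !bU bD in B1U; rewrite E2 !bU in B2U; rewrite E3 !bD in B2D.
split.
- by apply/eqP; rewrite -subr_eq0 B2U.
- by apply/eqP; rewrite -subr_eq0 B2D.
by apply/esym/eqP; rewrite -subr_eq0 -B1U; apply/eqP; ring.
Qed.

Lemma size_mulXn_le (p : {poly K}) i n : (size ('X^i * p)%R <= i + n)%N ->
  (size p <= n)%N.
Proof.
have [->|p0] := eqVneq p 0; first by rewrite size_poly0.
by rewrite size_monicM ?monicXn // size_polyXn /= leq_add2l.
Qed.

Hypothesis q0 : (0 < q)%N.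

(** As beta commutes with X, its values at (X^(q+1), 0) and (0, X^q) bound the degrees of its values
    at (1, 0) and (0, 1). These are (c, 0) and (s, d) with deg s <= 1, and A_2 (0, 1) = (X^2, 0)
    gives the last relation. *)
Lemma beta_scalar : exists c : K, forall w,
  beta_fst w = c%:P * fst_poly w /\ beta_snd w = c%:P * snd_poly w.
Proof.
pose f i := pair_rV q.+2 q.+1 ('X^i : {poly K}) 0.
pose g i := pair_rV q.+2 q.+1 (0 : {poly K}) 'X^i.
have sz (i n : nat) : (i < n)%N -> (size ('X^i : {poly K}) <= n)%N by rewrite
  size_polyXn.
have fS i : (i <= q)%N -> beta_fst (f i.+1) = 'X * beta_fst (f i) /\ beta_snd
  (f i.+1) = 'X * beta_snd (f i).
  move=> iq; have [B1 B2 _] := beta_module (pair_rV q.+1 q 'X^i 0).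
  have [[t0 t1 _] [r0 r1 _]] := cols_tensor (pair_rV q.+1 q ('X^i : {poly K}) 0).
  have c0 : (col o0 (tensor example (pair_rV q.+1 q 'X^i 0)))^T = f i.
    apply: eq_poly_pair; rewrite -/(col_fst _ _) -/(col_snd _ _) ?t0 ?r0 /f.
      by rewrite !fst_pair_rV ?sz // leqW.
    by rewrite !snd_pair_rV ?size_poly0.
  have c1 : (col o1 (tensor example (pair_rV q.+1 q 'X^i 0)))^T = f i.+1.
    apply: eq_poly_pair; rewrite -/(col_fst _ _) -/(col_snd _ _) ?t1 ?r1 /f.
      by rewrite !fst_pair_rV ?sz // exprS.
    by rewrite !snd_pair_rV ?size_poly0 // mulr0.
  by rewrite -c1 -c0.
have gS i : (i < q)%N -> beta_fst (g i.+1) = 'X * beta_fst (g i) /\ beta_snd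
  (g i.+1) = 'X * beta_snd (g i).
  move=> iq; have [B1 B2 _] := beta_module (pair_rV q.+1 q 0 'X^i).
  have [[t0 t1 _] [r0 r1 _]] := cols_tensor (pair_rV q.+1 q (0 : {poly K}) 'X^i).
  have c0 : (col o0 (tensor example (pair_rV q.+1 q 0 'X^i)))^T = g i.
    apply: eq_poly_pair; rewrite -/(col_fst _ _) -/(col_snd _ _) ?t0 ?r0 /g.
      by rewrite !fst_pair_rV ?size_poly0.
    by rewrite !snd_pair_rV ?sz // leqW // ltnW.
  have c1 : (col o1 (tensor example (pair_rV q.+1 q 0 'X^i)))^T = g i.+1.
    apply: eq_poly_pair; rewrite -/(col_fst _ _) -/(col_snd _ _) ?t1 ?r1 /g.
      by rewrite !fst_pair_rV ?size_poly0 // mulr0.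
    by rewrite !snd_pair_rV ?sz // exprS.
  by rewrite -c1 -c0.
have fX i : (i <= q.+1)%N -> beta_fst (f i) = 'X^i * beta_fst (f 0) /\ beta_snd
  (f i) = 'X^i * beta_snd (f 0).
  elim: i => [_|i IH iq]; first by rewrite !mul1r.
  by have [-> ->] := fS i iq; have [-> ->] := IH (ltnW iq); rewrite !mulrA !exprS.
have gX i : (i <= q)%N -> beta_fst (g i) = 'X^i * beta_fst (g 0) /\ beta_snd (g i)
  = 'X^i * beta_snd (g 0).
  elim: i => [_|i IH iq]; first by rewrite !mul1r.
  by have [-> ->] := gS i iq; have [-> ->] := IH (ltnW iq); rewrite !mulrA !exprS.
have sbU w : (size (beta_fst w) <= q.+2)%N by case: (image_pure w).
have sbD w : (size (beta_snd w) <= q.+1)%N by case: (image_pure w).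
have [fU fD] := fX q.+1 (leqnn _); have [gU gD] := gX q (leqnn _).
have cE : beta_fst (f 0) = ((beta_fst (f 0))`_0)%:P.
  by apply/size1_polyC/(@size_mulXn_le _ q.+1); rewrite -fU addn1.
have fD0 : beta_snd (f 0) = 0.
  apply/eqP; rewrite -size_poly_leq0.
  by apply: (@size_mulXn_le _ q.+1); rewrite -fD addn0.
have gU0 : (size (beta_fst (g 0)) <= 2)%N.
  by apply: (@size_mulXn_le _ q); rewrite -gU addn2.
have dE : beta_snd (g 0) = ((beta_snd (g 0))`_0)%:P.
  by apply/size1_polyC/(@size_mulXn_le _ q); rewrite -gD addn1.
have gf : beta_fst (f 2) = beta_fst (g 0) + 'X^2 * beta_snd (g 0).
  have [_ _ B] := beta_module (pair_rV q.+1 q 0 'X^0).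
  have [[t0 _ t2] [r0 _ r2]] := cols_tensor (pair_rV q.+1 q (0 : {poly K}) 'X^0).
  have c0 : (col o0 (tensor example (pair_rV q.+1 q 0 'X^0)))^T = g 0%N.
    apply: eq_poly_pair; rewrite -/(col_fst _ _) -/(col_snd _ _) ?t0 ?r0 /g.
      by rewrite !fst_pair_rV ?size_poly0.
    by rewrite !snd_pair_rV ?sz.
  have c2 : (col o2 (tensor example (pair_rV q.+1 q 0 'X^0)))^T = f 2%N.
    apply: eq_poly_pair; rewrite -/(col_fst _ _) -/(col_snd _ _) ?t2 ?r2 /f.
      by rewrite !fst_pair_rV ?snd_pair_rV ?size_poly0 ?sz // add0r mulr1.
    by rewrite snd_pair_rV ?size_poly0.
  by rewrite -c0 -c2.
(* X^2 is an admissible first component of N because q > 0. *)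
have [f2 _] := fX 2%N q0; rewrite f2 cE dE in gf.
set c := (beta_fst (f 0))`_0 in cE gf; set d := (beta_snd (g 0))`_0 in dE gf.
have cd : c = d.
  have := congr1 (fun p : {poly K} => p`_2) gf.
  rewrite coefD !coefXnM /= !coefC /= (nth_default _ gU0) add0r.
  by [].
have gU00 : beta_fst (g 0) = 0.
  by apply: (addIr ('X^2 * d%:P)); rewrite -gf cd add0r.
have fE i : (i <= q.+1)%N -> beta_fst (f i) = c%:P * 'X^i /\ beta_snd (f i) = 0.
  by move=> /fX[-> ->]; rewrite cE fD0 mulr0 mulrC.
have gE i : (i <= q)%N -> beta_fst (g i) = 0 /\ beta_snd (g i) = c%:P * 'X^i.
  by move=> /gX[-> ->]; rewrite dE gU00 cd mulr0 mulrC.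
exists c => w.
have wE : w = \sum_(i < q.+2) (fst_poly w)`_i *: f i +
              \sum_(i < q.+1) (snd_poly w)`_i *: g i.
  have poly_sum (p : {poly K}) n : (size p <= n)%N -> \sum_(i < n) p`_i *: 'X^i = p.
    move=> sp; rewrite -poly_def; apply/polyP => i; rewrite coef_poly.
    by case: ltnP => // /(leq_trans sp) /(nth_default 0) ->.
  apply: eq_poly_pair; rewrite linearD !linear_sum /=.
    rewrite [X in _ + X]big1 => [|i _]; last first.
      by rewrite linearZ /= fst_pair_rV ?size_poly0 ?scaler0.
    rewrite addr0 -[LHS](poly_sum _ _ (size_fst_poly w)); apply: eq_bigr => i _.
    by rewrite linearZ /= fst_pair_rV ?sz.
  rewrite [X in X + _]big1 => [|i _]; last first.
    by rewrite linearZ /= snd_pair_rV ?size_poly0 ?scaler0.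
  rewrite add0r -[LHS](poly_sum _ _ (size_snd_poly w)); apply: eq_bigr => i _.
  by rewrite linearZ /= snd_pair_rV ?sz.
pose good w := beta_fst w = c%:P * fst_poly w /\ beta_snd w = c%:P * snd_poly w.
have good0 : good 0.
  split; rewrite linear0 mulr0.
    by have := beta_fst_linear (-1) 0 0; rewrite scaler0 addr0 polyCN mulN1r addNr.
  by have := beta_snd_linear (-1) 0 0; rewrite scaler0 addr0 polyCN mulN1r addNr.
have goodP t w1 w2 : good w1 -> good w2 -> good (t *: w1 + w2).
  move=> [U1 D1] [U2 D2]; rewrite /good beta_fst_linear beta_snd_linear U1 D1 U2 D2.
  by split; rewrite linearP /= -mul_polyC; ring.
have goodS n (t : 'I_n -> K) (h : nat -> 'rV[K]_k) : (forall i : 'I_n, good (h i)) ->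
    good (\sum_(i < n) t i *: h i).
  by move=> gh; apply: big_rec => // i w' _; apply: goodP.
have goodf : good (\sum_(i < q.+2) (fst_poly w)`_i *: f i).
  apply: goodS => i; have [U D] := fE i (ltn_ord i).
  by rewrite /good U D fst_pair_rV ?sz // snd_pair_rV ?size_poly0 // mulr0.
have goodg : good (\sum_(i < q.+1) (snd_poly w)`_i *: g i).
  apply: goodS => i; have [U D] := gE i (ltn_ord i).
  by rewrite /good U D fst_pair_rV ?size_poly0 // snd_pair_rV ?sz // mulr0.
by rewrite -/(good w) wE -[X in good (X + _)]scale1r; apply: goodP.
Qed.

Lemma stabilizer_scalar : exists c, forall x a, E a - c *: a \in H x.
Proof.
have [c cE] := beta_scalar; exists c => x a; have [u ->] := image_decomp a.
set b := (\matrix_(_, _) _); suff -> : b = c *: a by rewrite addrC addKr tensor_fiber.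
have colb j : (col j b)^T = c *: (col j a)^T.
  have [sU sD _] := image_pure (col j a)^T; have [U D] := cE (col j a)^T.
  have -> : (col j b)^T = pair_rV q.+2 q.+1 (beta_fst (col j a)^T)
    (beta_snd (col j a)^T).
    by apply/rowP => l; rewrite !mxE.
  apply: eq_poly_pair; first by rewrite fst_pair_rV // U linearZ mul_polyC.
  by rewrite snd_pair_rV // D linearZ mul_polyC.
by apply/matrixP => l j; have /rowP/(_ l) := colb j; rewrite !mxE.
Qed.

End Stabilizer.

(** * Instability and conclusion *)

Lemma dim_limg_row_mx (a b : nat) : \dim (limg (linfun (mulmxr
  (row_mx 1%:M 0 : 'M[K]_(a, a + b)) : 'rV_a -> 'rV_(a + b)))) = a.
Proof.
rewrite limg_dim_eq ?dimvf /dim /= ?mul1n //.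
apply/eqP; rewrite capfv -subv0; apply/subvP => p; rewrite memv_ker lfunE /=.
rewrite mul_mx_row mulmx1 => /eqP E; rewrite memv0; apply/eqP.
by rewrite -[p](row_mxKl p (p *m (0 : 'M[K]_(a, b)))) E linear0.
Qed.

(* The pairs with second component 0 form a submodule of dimensions
   (q + 1, q + 2), and (q + 2) / (q + 1) < (2 q + 3) / (2 q + 1). *)
Lemma example_not_stable : ~ stable example.
Proof.
pose M' := limg (linfun (mulmxr
  (row_mx 1%:M 0 : 'M[K]_(q.+1, q.+1 + q)) : 'rV_(q.+1) -> 'rV_(q.+1 + q))).
pose N' := limg (linfun (mulmxr
  (row_mx 1%:M 0 : 'M[K]_(q.+2, q.+2 + q.+1)) : 'rV_(q.+2) -> 'rV_(q.+2 + q.+1))).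
have dM : \dim M' = q.+1 by apply: dim_limg_row_mx.
have dN : \dim N' = q.+2 by apply: dim_limg_row_mx.
move=> /(_ M' N'); rewrite -dimv_eq0 dM dN => /(_ isT).
have -> : N' != fullv.
  apply/eqP => /(congr1 (fun W : {vspace _} => \dim W)).
  by rewrite dN dimvf /dim /= mul1n; lia.
move=> /(_ isT).
have sub : forall (xi : 'cV[K]_3) (mu : 'rV[K]_(q.+1 + q)), mu \in M' ->
    example (xi *m mu) \in N'.
  move=> xi mu /memv_imgP[p _ ->]; rewrite !lfunE /=; apply/memv_imgP.
  exists (lsubmx (example_fun (xi *m (p *m row_mx 1%:M 0)))); rewrite ?memvf //.
  have snd0 j : snd_poly (row j (xi *m row_mx p 0) : 'rV[K]_(q.+1 + q)) = 0.
    by rewrite mul_mx_row row_row_mx mulmx0 /snd_poly row_mxKr row0 linear0.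
  rewrite lfunE /= mul_mx_row mulmx1 mulmx0 /example_fun /pair_rV row_mxKl.
  rewrite [RHS]mul_mx_row mulmx1 mulmx0; congr row_mx.
  by rewrite !snd0 mulr0 addr0 linear0.
move=> /(_ sub); rewrite ltr_pdivrMr ?ltr0n ?addn_gt0 // mulrAC.
by rewrite ltr_pdivlMr ?ltr0n // -!natrM ltr_nat; lia.
Qed.

End Example.

Lemma example_properties (K : closedFieldType) (q : nat) (q0 : (0 < q)%N) :
  [/\ injective_omor (bundle_map (example K q)), ~ stable (example K q) &
    exists (F : omod K) (p : omor (power (Q_omod K) (q.+2 + q.+1)) F),
      [/\ is_coker (bundle_map (example K q)) p, torsion_free F & simple F]].
Proof.
have inj := @example_injective K q.
split; [exact: bundle_map_injective | exact: example_not_stable |].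
exists (quot_omod (fiber_sub (example K q))), (coker_map (example K q)).
split; [exact: coker_map_is_coker | exact: quot_torsion_free |].
apply: quot_simple; first exact: example_global.
by move=> E EH; apply: stabilizer_scalar.
Qed.

Theorem proposition5p3 (R : realType) (n : nat) (hn : (1 < n)%N) :
  exists phi : 'Hom('M[R[i]]_(3, (2 * n - 1)%N), 'rV[R[i]]_((2 * n + 1)%N)),
    [/\ injective_omor (bundle_map phi),
        ~ stable phi &
        exists (F : omod R[i])
          (p : omor (power (Q_omod R[i]) (2 * n + 1)%N) F),
          [/\ is_coker (bundle_map phi) p, torsion_free F & simple F]].
Proof.
(* With q = n - 1 the two dimensions split into the block sizes of the pairs of polynomials. *)
have -> : (2 * n - 1 = n.-1.+1 + n.-1)%N by lia.
have -> : (2 * n + 1 = n.-1.+2 + n.-1.+1)%N by lia.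
exists (example R[i] n.-1); apply: example_properties.
by case: n hn => [|[]].
Qed.
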